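(* Let $K$ be an arbitrary field of characteristic $p>0$. For any nonzero $\mathcal D(P_n)$-module $M$ there exist a subalgebra $\Lambda$ of $\mathcal D(P_n)$ of the type $P_s\otimes\bigotimes_{i=1}^{n-s}\Lambda_{-1}^{[p^{k_i}]}$, for some $0\le s\le n$ and $k_i\ge0$, and a finite dimensional $K$-subspace $V$ of $M$ such that $\dim_K(V)\ge p^{k_1+\cdots+k_{n-s}}$ and the natural map $\Lambda\otimes V\to\Lambda V$, $\lambda\otimes v\mapsto\lambda v$ (in $M$), is an isomorphism of $\Lambda$-modules.
   Context: $\otimes=\otimes_K$; modules are left modules. $P_n=K[x_1,\dots,x_n]$, $n\ge1$; $\mathcal D(P_n)$ is the ring of $K$-linear differential operators on $P_n$. For $j\ge0$, $\partial_i^{[j]}=\frac{\partial_i^j}{j!}$ is the operator $x^\alpha\mapsto\binom{\alpha_i}{j}x^{\alpha-je_i}$ (zero if $j>\alpha_i$). $\mathcal D(P_n)=\bigotimes_{i=1}^n\mathcal D(K[x_i])\simeq\mathcal D(P_1)^{\otimes n}$. In $\mathcal D(P_1)=\mathcal D(K[x])$, for $k\ge0$, $\Lambda_{-1}^{[p^k]}:=\bigoplus_{j\ge0}K\partial^{[jp^k]}$, a commutative subalgebra. A subalgebra of $\mathcal D(P_n)$ is of type $P_s\otimes\bigotimes_{i=1}^{n-s}\Lambda_{-1}^{[p^{k_i}]}$ if, after changing if necessary the order of the tensor factors in $\mathcal D(P_n)=\mathcal D(P_1)\otimes\cdots\otimes\mathcal D(P_1)$, it equals $P_1^{\otimes s}\otimes\Lambda_{-1}^{[p^{k_1}]}\otimes\cdots\otimes\Lambda_{-1}^{[p^{k_{n-s}}]}$.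 *)

(* Defs.v *)
From HB Require Import structures.
From mathcomp Require Import all_boot perm all_algebra generic_quotient.
From mathcomp Require Import boolp bigenough ssrcomplements mpoly.
From mathcomp Require Import zify.

Set Implicit Arguments.
Unset Strict Implicit.
Unset Printing Implicit Defensive.

Import GRing.Theory BigEnough.
Local Open Scope ring_scope.
Local Open Scope quotient_scope.

Section DiffOp.
Variables (K : fieldType) (R : comAlgType K).

(* Grothendieck's filtration: D_0 = End_R(R), and u is in D_(m+1) if and only
   if the commutator [r, u] is in D_m for every r in R. *)
Fixpoint diff_order (m : nat) (u : R -> R) : Prop :=
  if m is m'.+1 then forall r, diff_order m' (fun f => r * u f - u (r * f))
  else forall r f, r * u f = u (r * f).

Record diffop := DiffOp {
  diffop_fun :> R -> R;
  _ : linear diffop_fun;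
  diffopP : exists m, diff_order m diffop_fun }.

HB.instance Definition _ := gen_eqMixin diffop.
HB.instance Definition _ := gen_choiceMixin diffop.

Fact diffop_linear (u : diffop) : linear u. Proof. by case: u. Qed.

HB.instance Definition _ (u : diffop) :=
  GRing.isLinear.Build K R R _ u (@diffop_linear u).

Lemma diffop_eq (u v : diffop) : u =1 v -> u = v.
Proof.
case: u v => [u lu ou] [v lv ov] /= /funext uv; subst v.
by congr DiffOp; exact: Prop_irrelevance.
Qed.

Lemma eq_diff_order m u v : u =1 v -> diff_order m u -> diff_order m v.
Proof. by move=> /funext ->. Qed.

Lemma diff_order0 m : diff_order m (fun=> 0 : R).
Proof.
elim: m => [|m IH] r /= => [f|]; first by rewrite mulr0.
by apply: eq_diff_order IH => f; rewrite mulr0 subr0.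
Qed.

Lemma diff_orderS m u : diff_order m u -> diff_order m.+1 u.
Proof.
elim: m u => [|m IH] u ou r; last exact/IH/ou.
by apply: eq_diff_order (diff_order0 0) => f; rewrite ou subrr.
Qed.

Lemma diff_order_leq m m' u : (m <= m')%N -> diff_order m u -> diff_order m' u.
Proof.
move/subnK <-; elim: (m' - m)%N => // d IH ou.
by rewrite addSn; exact/diff_orderS/IH.
Qed.

Lemma diff_orderD m u v :
  diff_order m u -> diff_order m v -> diff_order m (fun f => u f + v f).
Proof.
elim: m u v => [|m IH] u v ou ov r /= => [f|].
  by rewrite mulrDr ou ov.
apply: eq_diff_order (IH _ _ (ou r) (ov r)) => f.
by rewrite mulrDr opprD addrACA.
Qed.

Lemma diff_orderM a b u v : {morph u : x y / x - y} ->
  diff_order a u -> diff_order b v -> diff_order (a + b) (u \o v).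
Proof.
have [m] := ubnP (a + b); elim: m => // m IH in a b u v *.
move=> lem au ou ov.
have aC r : {morph (fun f => r * u f - u (r * f)) : x y / x - y}.
  by move=> x y; rewrite au mulrBr mulrBr au !opprD addrACA.
case: a lem ou => [|a] lem ou; case: b lem ov => [|b] lem ov.
- by move=> r f /=; rewrite ou ov.
- move=> r; apply: eq_diff_order (IH 0%N b _ _ _ au ou (ov r)) => //.
  by move=> f /=; rewrite au ou.
- rewrite addn0 => r.
  apply: eq_diff_order (_ : diff_order _ ((fun f => r * u f - u (r * f)) \o v)).
    by move=> f /=; rewrite ov.
  have := IH a 0%N _ v _ (aC r) (ou r) ov; rewrite addn0; apply.
  by move: lem; rewrite addn0.
- rewrite addSn => r.
  have o1 : diff_order (a + b.+1) ((fun f => r * u f - u (r * f)) \o v).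
    exact: (IH a b.+1 _ v lem (aC r) (ou r) ov).
  have o2 : diff_order (a + b.+1) (u \o (fun f => r * v f - v (r * f))).
    have := IH a.+1 b u _ _ au ou (ov r); rewrite addSn addnS; apply.
    by move: lem; rewrite addnS.
  apply: eq_diff_order (diff_orderD o1 o2) => f /=.
  by rewrite au addrA subrK.
Qed.

Definition mulop_fun (r : R) (f : R) : R := r * f.

Fact mulop_linear r : linear (mulop_fun r).
Proof. by move=> c f g; rewrite /mulop_fun mulrDr scalerAr. Qed.

Fact mulop_order r : diff_order 0 (mulop_fun r).
Proof. by move=> s f; rewrite /mulop_fun mulrCA. Qed.

(* The copy of R inside D(R), acting on R by multiplication. *)
Definition mulop (r : R) : diffop :=
  DiffOp (mulop_linear r) (ex_intro _ 0%N (mulop_order r)).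

Fact diffop_add_linear (u v : diffop) : linear (fun f => u f + v f).
Proof. by move=> c f g; rewrite !linearP scalerDr addrACA. Qed.

Fact diffop_addP (u v : diffop) :
  exists m, diff_order m (fun f => u f + v f).
Proof.
have [[a ou] [b ov]] := (diffopP u, diffopP v); exists (maxn a b).
by apply: diff_orderD; [apply: diff_order_leq ou|apply: diff_order_leq ov];
   rewrite ?leq_maxl ?leq_maxr.
Qed.

Definition diffop_add u v := DiffOp (diffop_add_linear u v) (diffop_addP u v).

Fact diffop_mul_linear (u v : diffop) : linear (u \o v).
Proof. by move=> c f g; rewrite /= !linearP. Qed.

Fact diffop_mulP (u v : diffop) : exists m, diff_order m (u \o v).
Proof.
have [[a ou] [b ov]] := (diffopP u, diffopP v); exists (a + b)%N.
by apply: diff_orderM => //; exact: raddfB.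
Qed.

Definition diffop_mul u v := DiffOp (diffop_mul_linear u v) (diffop_mulP u v).

Definition diffop_opp u := diffop_mul (mulop (-1)) u.

Definition diffop_scale (c : K) u := diffop_mul (mulop c%:A) u.

Fact diffop_addA : associative diffop_add.
Proof. by move=> u v w; apply: diffop_eq => f /=; rewrite addrA. Qed.

Fact diffop_addC : commutative diffop_add.
Proof. by move=> u v; apply: diffop_eq => f /=; rewrite addrC. Qed.

Fact diffop_add0 : left_id (mulop 0) diffop_add.
Proof. by move=> u; apply: diffop_eq => f; rewrite /= /mulop_fun mul0r add0r. Qed.

Fact diffop_addN : left_inverse (mulop 0) diffop_opp diffop_add.
Proof.
move=> u; apply: diffop_eq => f.
by rewrite /= /mulop_fun mul0r mulN1r addNr.
Qed.

HB.instance Definition _ := GRing.isZmodule.Build diffop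
  diffop_addA diffop_addC diffop_add0 diffop_addN.

Fact diffop_mulA : associative diffop_mul.
Proof. by move=> u v w; apply: diffop_eq. Qed.

Fact diffop_mul1l : left_id (mulop 1) diffop_mul.
Proof. by move=> u; apply: diffop_eq => f; rewrite /= /mulop_fun mul1r. Qed.

Fact diffop_mul1r : right_id (mulop 1) diffop_mul.
Proof. by move=> u; apply: diffop_eq => f; rewrite /= /mulop_fun mul1r. Qed.

Fact diffop_mulDl : left_distributive diffop_mul +%R.
Proof. by move=> u v w; apply: diffop_eq. Qed.

Fact diffop_mulDr : right_distributive diffop_mul +%R.
Proof. by move=> u v w; apply: diffop_eq => f /=; rewrite raddfD. Qed.

Fact diffop_one_neq0 : mulop 1 != 0.
Proof.
apply/eqP => /(congr1 (fun u : diffop => u 1)).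
by rewrite /= /mulop_fun mul1r mul0r => /eqP; rewrite oner_eq0.
Qed.

HB.instance Definition _ := GRing.Zmodule_isNzRing.Build diffop
  diffop_mulA diffop_mul1l diffop_mul1r diffop_mulDl diffop_mulDr
  diffop_one_neq0.

Fact diffop_scaleA a b u :
  diffop_scale a (diffop_scale b u) = diffop_scale (a * b) u.
Proof.
by apply: diffop_eq => f; rewrite /= /mulop_fun -!scalerAl !mul1r scalerA.
Qed.

Fact diffop_scale1 : left_id 1 diffop_scale.
Proof.
by move=> u; apply: diffop_eq => f; rewrite /= /mulop_fun scale1r mul1r.
Qed.

Fact diffop_scaleDr : right_distributive diffop_scale +%R.
Proof. by move=> a u v; exact: mulrDr. Qed.

Fact diffop_scaleDl u : {morph diffop_scale^~ u : a b / a + b}.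
Proof.
by move=> a b; apply: diffop_eq => f; rewrite /= /mulop_fun scalerDl mulrDl.
Qed.

HB.instance Definition _ := GRing.Zmodule_isLmodule.Build K diffop
  diffop_scaleA diffop_scale1 diffop_scaleDr diffop_scaleDl.

Fact diffop_scaleAl (a : K) (u v : diffop) : a *: (u * v) = (a *: u) * v.
Proof. exact: mulrA. Qed.

HB.instance Definition _ := GRing.Lmodule_isLalgebra.Build K diffop
  diffop_scaleAl.

Fact diffop_scaleAr (a : K) (u v : diffop) : a *: (u * v) = u * (a *: v).
Proof.
apply: diffop_eq => f.
by rewrite /= /mulop_fun -!scalerAl !mul1r linearZ.
Qed.

HB.instance Definition _ := GRing.Lalgebra_isAlgebra.Build K diffop
  diffop_scaleAr.

Lemma diffop_addE (u v : diffop) f : (u + v) f = u f + v f.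
Proof. by []. Qed.

Lemma diffop_mulE (u v : diffop) f : (u * v) f = u (v f).
Proof. by []. Qed.

Lemma diffop_scaleE (a : K) (u : diffop) f : (a *: u) f = a *: u f.
Proof. by rewrite /= /mulop_fun -scalerAl mul1r. Qed.

Lemma mulopE r f : mulop r f = r * f.
Proof. by []. Qed.

End DiffOp.

Arguments diffop {K} R.
Arguments mulop {K R} r.

Section DividedPower.
Variables (K : fieldType) (n : nat).
Local Notation P := {mpoly K[n]}.

(* Where the truncated subtraction of exponents is not the true one, the
   binomial coefficient vanishes. *)
Definition dpow_fun (i : 'I_n) (j : nat) (f : P) : P :=
  \sum_(m <- msupp f) ('C(m i, j)%:R * f@_m) *: 'X_[m - U_(i) *+ j].

Fact dpow_funwE i j f k : (msize f <= k)%N ->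
  dpow_fun i j f =
    \sum_(m : 'X_{1..n < k}) ('C(m i, j)%:R * f@_m) *: 'X_[m - U_(i) *+ j].
Proof.
pose I : subFinType _ := 'X_{1..n < k}.
move=> le_fk; rewrite /dpow_fun (big_mksub I) /=; first last.
- by move=> x /msize_mdeg_lt/leq_trans/(_ le_fk).
- by rewrite msupp_uniq.
rewrite big_rmcond //= => m /memN_msupp_eq0 ->.
by rewrite mulr0 scale0r.
Qed.

Fact dpow_linear i j : linear (dpow_fun i j).
Proof.
move=> c f g; pose_big_enough k; first rewrite !(@dpow_funwE i j _ k) //.
  rewrite scaler_sumr -big_split /=; apply/eq_bigr=> m _.
  by rewrite !scalerA -scalerDl mcoeffD mcoeffZ mulrDr mulrCA.
by close.
Qed.

Lemma dpow_funX i j m :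
  dpow_fun i j 'X_[m] = 'C(m i, j)%:R *: 'X_[m - U_(i) *+ j].
Proof. by rewrite /dpow_fun msuppX big_seq1 mcoeffX eqxx mulr1. Qed.

Let commutator i j (r f : P) := r * dpow_fun i j f - dpow_fun i j (r * f).

Fact dpow_additive i j : {morph dpow_fun i j : f g / f - g}.
Proof.
move=> f g; rewrite addrC -scaleN1r dpow_linear scaleN1r.
exact: addrC.
Qed.

Fact dpow_commX i j l f :
  commutator i j.+1 'X_l f = - ((l == i)%:R *: dpow_fun i j f).
Proof.
have lC r : linear (fun f => r * dpow_fun i j.+1 f - dpow_fun i j.+1 (r * f)).
  move=> c g h; rewrite mulrDr -scalerAr !dpow_linear mulrDr -scalerAr.
  by rewrite scalerBr opprD addrACA.
rewrite /commutator; elim/mpolyind: f => [|c m f _ _ IH].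
  have d0 k : dpow_fun i k 0 = 0 by rewrite /dpow_fun msupp0 big_nil.
  by rewrite mulr0 !d0 mulr0 subr0 scaler0 oppr0.
rewrite lC IH dpow_linear [in RHS]scalerDr [in RHS]opprD; congr (_ + _).
rewrite scalerA [_ * c]mulrC -scalerA -scalerN; congr (_ *: _).
rewrite -mpolyXD !dpow_funX -scalerAr -mpolyXD.
rewrite mnmDE mnm1E.
have [->|neq_li] := eqVneq l i; last first.
  rewrite add0n scale0r oppr0; apply/eqP; rewrite subr_eq0; apply/eqP.
  congr (_ *: 'X_[_]); apply/mnmP => k; rewrite !(mnmDE, mnmBE, mulmnE, mnm1E).
  have [<-|] := eqVneq i k; last by rewrite mul0n !subn0.
  by rewrite (negbTE neq_li).
rewrite scale1r add1n binS natrD scalerDl opprD addrA.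
rewrite (_ : (U_(i) + m - U_(i) *+ j.+1 = m - U_(i) *+ j)%MM); last first.
  by apply/mnmP => k; rewrite !(mnmDE, mnmBE, mulmnE, mnm1E); case: (i == k); lia.
have [lt_mj|le_jm] := ltnP (m i) j.+1.
  by rewrite (bin_small lt_mj) !scale0r subrr add0r.
rewrite (_ : (U_(i) + (m - U_(i) *+ j.+1) = m - U_(i) *+ j)%MM); last first.
  apply/mnmP => k; rewrite !(mnmDE, mnmBE, mulmnE, mnm1E).
  by have [<-|] := eqVneq i k; lia.
by rewrite subrr add0r.
Qed.

Fact dpow_order i j : diff_order j (dpow_fun i j).
Proof.
elim: j => [|j IH] => [r f|].
  have d0 g : dpow_fun i 0 g = g.
    rewrite [RHS]mpolyE /dpow_fun; apply: eq_bigr => m _.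
    by rewrite bin0 mul1r mulm0n subm0.
  by rewrite !d0.
have oC r s : diff_order j (commutator i j.+1 r) ->
    diff_order j (commutator i j.+1 s) ->
    diff_order j (commutator i j.+1 (r * s)).
  move=> or os.
  have o1 : diff_order j (mulop_fun r \o commutator i j.+1 s).
    apply: (@diff_orderM _ _ 0 j) => //; last exact: mulop_order.
    by move=> f g; rewrite /mulop_fun mulrBr.
  have o2 : diff_order (j + 0) (commutator i j.+1 r \o mulop_fun s).
    apply: diff_orderM => //; last exact: mulop_order.
    move=> f g; rewrite /commutator !mulrBr !dpow_additive mulrBr.
    by rewrite !opprD addrACA.
  rewrite addn0 in o2; apply: eq_diff_order (diff_orderD o1 o2) => f.
  by rewrite /commutator /= /mulop_fun mulrBr !mulrA addrA subrK.
have o1 : diff_order j (commutator i j.+1 1).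
  by apply: eq_diff_order (diff_order0 _ j) => f; rewrite /commutator !mul1r subrr.
move=> r; rewrite -/(commutator i j.+1 r).
elim/mpolyind: r => [|c m r _ _ or].
  apply: eq_diff_order (diff_order0 _ j) => f.
  by rewrite /commutator !mul0r /dpow_fun msupp0 big_nil subr0.
have om : diff_order j (commutator i j.+1 'X_[m]).
  rewrite mpolyXE_id.
  apply: (big_ind (fun r => diff_order j (commutator i j.+1 r))) => // l _.
  elim: (m l) => [|k IHk]; rewrite ?expr0 ?exprS //; apply: oC => //.
  have o : diff_order (0 + j) (mulop_fun (- (l == i)%:R%:MP) \o dpow_fun i j).
    apply: diff_orderM => //; last exact: mulop_order.
    by move=> f g; rewrite /mulop_fun mulrBr.
  apply: eq_diff_order o => f.
  by rewrite dpow_commX /= /mulop_fun mulNr mul_mpolyC.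
have o : diff_order (0 + j) (mulop_fun c%:MP \o commutator i j.+1 'X_[m]).
  apply: diff_orderM => //; last exact: mulop_order.
  by move=> f g; rewrite /mulop_fun mulrBr.
apply: eq_diff_order (diff_orderD o or) => f; rewrite /commutator /= /mulop_fun.
rewrite mul_mpolyC ![(c *: _ + r) * _]mulrDl -![(c *: _) * _]scalerAl.
by rewrite dpow_linear scalerBr opprD addrACA.
Qed.

Definition dpow (i : 'I_n) (j : nat) : diffop P :=
  DiffOp (dpow_linear i j) (ex_intro _ j (dpow_order i j)).

End DividedPower.

Section Submodule.
Variables (K : pzRingType) (W : lmodType K).

Inductive submod (S : submodClosed W) : predArgType :=
  Submod (x : W) & x \in S.

Definition submod_val S (x : submod S) := let: Submod x _ := x in x.

Variable S : submodClosed W.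

HB.instance Definition _ := [isSub of submod S for @submod_val S].
HB.instance Definition _ := [Choice of submod S by <:].
HB.instance Definition _ := [SubChoice_isSubLmodule of submod S by <:].

End Submodule.

Section Subalgebra.
Variables (K : pzRingType) (A : algType K).

Inductive subalg (S : subalgClosed A) : predArgType :=
  Subalg (x : A) & x \in S.

Definition subalg_val S (x : subalg S) := let: Subalg x _ := x in x.

Variable S : subalgClosed A.

HB.instance Definition _ := [isSub of subalg S for @subalg_val S].
HB.instance Definition _ := [Choice of subalg S by <:].
HB.instance Definition _ := [SubChoice_isSubAlgebra of subalg S by <:].

End Subalgebra.

Definition lin_span (K : pzRingType) (W : lmodType K) (B : W -> Prop) (x : W) :
    Prop :=
  exists2 s : seq (K * W), (forall y, y \in s -> B y.2) &
    x = \sum_(y <- s) y.1 *: y.2.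

Section Restriction.
Variables (A B : pzRingType).

(* The A-module obtained from M by restriction of scalars along f. *)
Definition restr (f : {rmorphism A -> B}) (M : lmodType B) : Type := M.

Variables (f : {rmorphism A -> B}) (M : lmodType B).

HB.instance Definition _ := GRing.Zmodule.on (restr f M).

Definition restr_scale (a : A) (x : restr f M) : restr f M := f a *: (x : M).

Fact restr_scaleA a b x :
  restr_scale a (restr_scale b x) = restr_scale (a * b) x.
Proof. by rewrite /restr_scale scalerA rmorphM. Qed.

Fact restr_scale1 : left_id 1 restr_scale.
Proof. by move=> x; rewrite /restr_scale rmorph1 scale1r. Qed.

Fact restr_scaleDr : right_distributive restr_scale +%R.
Proof. by move=> a x y; exact: scalerDr. Qed.

Fact restr_scaleDl x : {morph restr_scale^~ x : a b / a + b}.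
Proof. by move=> a b; rewrite /restr_scale rmorphD; exact: scalerDl. Qed.

HB.instance Definition _ := GRing.Zmodule_isLmodule.Build A (restr f M)
  restr_scaleA restr_scale1 restr_scaleDr restr_scaleDl.

End Restriction.

Section Tensor.
Variables (K : fieldType) (A : algType K) (V : lmodType K).

(* The sequence [:: (a_1, v_1); ...; (a_m, v_m)] stands for the formal sum
   a_1 (x) v_1 + ... + a_m (x) v_m. *)
Inductive tensor_rel : seq (A * V) -> seq (A * V) -> Prop :=
| TensorRefl s : tensor_rel s s
| TensorSym s t : tensor_rel s t -> tensor_rel t s
| TensorTrans s t u : tensor_rel s t -> tensor_rel t u -> tensor_rel s u
| TensorCat s s' t t' :
    tensor_rel s s' -> tensor_rel t t' -> tensor_rel (s ++ t) (s' ++ t')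
| TensorCatC s t : tensor_rel (s ++ t) (t ++ s)
| Tensor0 v : tensor_rel [:: (0, v)] [::]
| TensorDl a b v : tensor_rel [:: (a + b, v)] [:: (a, v); (b, v)]
| TensorDr a v w : tensor_rel [:: (a, v + w)] [:: (a, v); (a, w)]
| TensorZ (c : K) a v : tensor_rel [:: (c *: a, v)] [:: (a, c *: v)].

Definition tensor_eq : rel (seq (A * V)) := fun s t => `[< tensor_rel s t >].

Fact tensor_eq_equiv : equiv_class_of tensor_eq.
Proof.
split=> [s|s t|t s u]; first exact/asboolP/TensorRefl.
  by apply/asboolP/asboolP; exact: TensorSym.
by move=> /asboolP st /asboolP tu; apply/asboolP; exact: TensorTrans st tu.
Qed.

Canonical tensor_equiv := EquivRelPack tensor_eq_equiv.

Definition tensor := {eq_quot tensor_equiv}.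

HB.instance Definition _ := EqQuotient.on tensor.
HB.instance Definition _ := Choice.on tensor.

Lemma tensor_eqP (s t : seq (A * V)) :
  \pi_tensor s = \pi_tensor t <-> tensor_rel s t.
Proof.
split=> [/eqP|st]; first by rewrite eqmodE => /asboolP.
by apply/eqP; rewrite eqmodE; apply/asboolP.
Qed.

Lemma tensor_repr (s : seq (A * V)) : tensor_rel (repr (\pi_tensor s)) s.
Proof. by apply/tensor_eqP; rewrite reprK. Qed.

Definition tensor_add (x y : tensor) : tensor := \pi_tensor (repr x ++ repr y).

(* a *: (b_1 (x) v_1 + ...) = a b_1 (x) v_1 + ... *)
Definition tensor_map (a : A) (s : seq (A * V)) :=
  [seq (a * y.1, y.2) | y <- s].

Definition tensor_scale (a : A) (x : tensor) : tensor :=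
  \pi_tensor (tensor_map a (repr x)).

Fact tensor_map_rel a s t :
  tensor_rel s t -> tensor_rel (tensor_map a s) (tensor_map a t).
Proof.
elim=> {s t} /=.
- by move=> s; exact: TensorRefl.
- by move=> s t _; exact: TensorSym.
- by move=> s t u _ st _; exact: TensorTrans.
- by move=> s s' t t' _ ? _ ?; rewrite /tensor_map !map_cat; exact: TensorCat.
- by move=> s t; rewrite /tensor_map !map_cat; exact: TensorCatC.
- by move=> v; rewrite mulr0; exact: Tensor0.
- by move=> b c v; rewrite mulrDr; exact: TensorDl.
- by move=> b v w; exact: TensorDr.
- by move=> c b v; rewrite -scalerAr; exact: TensorZ.
Qed.

Fact tensor_add_pi s t :
  tensor_add (\pi_tensor s) (\pi_tensor t) = \pi_tensor (s ++ t).
Proof. by apply/tensor_eqP/TensorCat; exact: tensor_repr. Qed.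

Fact tensor_scale_pi a s :
  tensor_scale a (\pi_tensor s) = \pi_tensor (tensor_map a s).
Proof. by apply/tensor_eqP/tensor_map_rel; exact: tensor_repr. Qed.

Definition tensor_zero : tensor := \pi_tensor [::].

Definition tensor_opp (x : tensor) : tensor := tensor_scale (-1) x.

Fact tensor_addA : associative tensor_add.
Proof.
elim/quotW => x; elim/quotW => y; elim/quotW => z.
rewrite (tensor_add_pi y z) (tensor_add_pi x y).
by rewrite (tensor_add_pi x (y ++ z)) (tensor_add_pi (x ++ y) z) catA.
Qed.

Fact tensor_addC : commutative tensor_add.
Proof.
elim/quotW => x; elim/quotW => y.
rewrite (tensor_add_pi x y) (tensor_add_pi y x).
exact/tensor_eqP/TensorCatC.
Qed.

Fact tensor_add0 : left_id tensor_zero tensor_add.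
Proof. by elim/quotW => x; rewrite tensor_add_pi. Qed.

Fact tensor_map_Dl (a b : A) s : tensor_rel
  (tensor_map (a + b) s) (tensor_map a s ++ tensor_map b s).
Proof.
elim: s => [|[c v] s IH] /=; first exact: TensorRefl.
rewrite mulrDl; apply: TensorTrans (TensorCat (TensorDl _ _ _) IH) _.
rewrite [X in tensor_rel _ X](_ : _ = [:: (a * c, v)] ++
  ((tensor_map a s ++ [:: (b * c, v)]) ++ tensor_map b s)); last first.
  by rewrite -catA.
rewrite [X in tensor_rel X](_ : _ = [:: (a * c, v)] ++
  (([:: (b * c, v)] ++ tensor_map a s) ++ tensor_map b s)) //.
apply: TensorCat (TensorRefl _) (TensorCat _ (TensorRefl _)).
exact: TensorCatC.
Qed.

Fact tensor_map0 s : tensor_rel (tensor_map 0 s) [::].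
Proof.
elim: s => [|[c v] s IH] /=; first exact: TensorRefl.
by rewrite mul0r; exact: (TensorCat (Tensor0 v) IH).
Qed.

Fact tensor_map1 s : tensor_map 1 s = s.
Proof. by elim: s => [|[a v] s IH] //=; rewrite mul1r IH. Qed.

Fact tensor_addN : left_inverse tensor_zero tensor_opp tensor_add.
Proof.
elim/quotW => x; rewrite /tensor_opp (tensor_scale_pi (-1) x).
rewrite (tensor_add_pi _ x); apply/tensor_eqP.
have := tensor_map_Dl (-1) 1 x; rewrite addNr tensor_map1 => /TensorSym rx.
exact: TensorTrans rx (tensor_map0 x).
Qed.

HB.instance Definition _ := GRing.isZmodule.Build tensor
  tensor_addA tensor_addC tensor_add0 tensor_addN.

Fact tensor_scaleA a b x :
  tensor_scale a (tensor_scale b x) = tensor_scale (a * b) x.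
Proof.
elim/quotW: x => x; rewrite (tensor_scale_pi b x) (tensor_scale_pi (a * b) x).
rewrite (tensor_scale_pi a (tensor_map b x)) /tensor_map -map_comp.
by congr (\pi_tensor _); apply: eq_map => y /=; rewrite mulrA.
Qed.

Fact tensor_scale1 : left_id 1 tensor_scale.
Proof. by elim/quotW => x; rewrite (tensor_scale_pi 1 x) tensor_map1. Qed.

Fact tensor_scaleDr : right_distributive tensor_scale +%R.
Proof.
move=> a; elim/quotW => x; elim/quotW => y.
rewrite (tensor_scale_pi a x) (tensor_scale_pi a y).
rewrite [X in tensor_scale a X](tensor_add_pi x y) [RHS]tensor_add_pi.
by rewrite tensor_scale_pi /tensor_map map_cat.
Qed.

Fact tensor_scaleDl x : {morph tensor_scale^~ x : a b / a + b}.
Proof.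
elim/quotW: x => x a b /=; rewrite (tensor_scale_pi a x) (tensor_scale_pi b x).
rewrite (tensor_scale_pi (a + b) x) [RHS]tensor_add_pi.
exact/tensor_eqP/tensor_map_Dl.
Qed.

HB.instance Definition _ := GRing.Zmodule_isLmodule.Build A tensor
  tensor_scaleA tensor_scale1 tensor_scaleDr tensor_scaleDl.

Definition pure (a : A) (v : V) : tensor := \pi_tensor [:: (a, v)].

End Tensor.

Section NaturalMap.
Variables (K : fieldType) (D : algType K) (M : lmodType D).
Variables (L : subalgClosed D) (V : submodClosed (restr (GRing.in_alg D) M)).

Let ML : lmodType (subalg L) :=
  restr (val : {rmorphism subalg L -> D}) M.

Definition act (s : seq (subalg L * submod V)) : ML :=
  \sum_(y <- s) val y.1 *: (val y.2 : M).

(* The L-submodule L V of M. *)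
Definition mulspan : {pred ML} := fun x => `[< exists s, x = act s >].

Lemma mulspanP x : reflect (exists s, x = act s) (x \in mulspan).
Proof. exact: asboolP. Qed.

Fact act_cat s t : act (s ++ t) = act s + act t.
Proof. by rewrite /act big_cat. Qed.

Fact act_map a s : act (tensor_map a s) = a *: act s.
Proof.
rewrite /act /tensor_map big_map [RHS]scaler_sumr.
by apply: eq_bigr => y _; rewrite -scalerA.
Qed.

Fact mulspan_closed : submod_closed mulspan.
Proof.
split; first by apply/mulspanP; exists [::]; rewrite /act big_nil.
move=> a x y /mulspanP[s ->] /mulspanP[t ->]; apply/mulspanP.
by exists (tensor_map a s ++ t); rewrite act_cat act_map.
Qed.

HB.instance Definition _ :=
  GRing.isSubmodClosed.Build (subalg L) ML mulspan mulspan_closed.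

Fact act_rel s t : tensor_rel s t -> act s = act t.
Proof.
elim=> {s t} //.
- by move=> s t u _ -> _ ->.
- by move=> s s' t t' _ es _ et; rewrite !act_cat es et.
- by move=> s t; rewrite !act_cat addrC.
- by move=> v; rewrite /act big_seq1 big_nil /= scale0r.
- by move=> a b v; rewrite /act big_seq1 !big_cons big_nil addr0 /= scalerDl.
- by move=> a v w; rewrite /act big_seq1 !big_cons big_nil addr0 /= scalerDr.
- move=> c a v; rewrite /act !big_seq1 /=.
  rewrite [RHS](_ : _ = val a *: (c%:A *: (val v : M))) //.
  by rewrite scalerA -scalerAr mulr1.
Qed.

Fact natural_fun_subproof (t : tensor (subalg L) (submod V)) :
  act (repr t) \in mulspan.
Proof. by apply/mulspanP; exists (repr t). Qed.

Definition natural_fun (t : tensor (subalg L) (submod V)) : submod mulspan :=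
  Submod (natural_fun_subproof t).

Lemma val_natural_fun_pi s : val (natural_fun (\pi s)) = act s.
Proof. exact/act_rel/tensor_repr. Qed.

Lemma natural_fun_pure l v :
  val (natural_fun (pure l v)) = val l *: (val v : M).
Proof. by rewrite val_natural_fun_pi /act big_seq1. Qed.

Fact natural_fun_linear : linear natural_fun.
Proof.
move=> a; elim/quotW => x; elim/quotW => y; apply: val_inj.
rewrite [X in natural_fun (X + _)]tensor_scale_pi.
rewrite [X in natural_fun X]tensor_add_pi.
rewrite [RHS]/= val_natural_fun_pi act_cat act_map.
by congr (_ *: _ + _); apply/esym/act_rel/tensor_repr.
Qed.

HB.instance Definition _ := GRing.isLinear.Build (subalg L)
  (tensor (subalg L) (submod V)) (submod mulspan) _ natural_fun
  natural_fun_linear.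

(* The map L (x) V -> L V, l (x) v |-> l v, of L-modules. *)
Definition natural_map :
  {linear tensor (subalg L) (submod V) -> submod mulspan} := natural_fun.

Lemma natural_map_pure l v :
  val (natural_map (pure l v)) = val l *: (val v : M).
Proof. exact: natural_fun_pure. Qed.

End NaturalMap.

Arguments natural_map {K D M} L V.

Definition lmod_iso (A : pzRingType) (U W : lmodType A)
  (f : {linear U -> W}) := bijective f.

Section Types.
Variables (K : fieldType) (n : nat).
Local Notation D := (diffop {mpoly K[n]}).

(* P_1 = K[x_i] in the i-th tensor factor of D(P_n) = D(P_1)^(x)n. *)
Definition P_factor (i : 'I_n) : D -> Prop :=
  lin_span (fun u => exists j : nat, u = mulop ('X_i ^+ j)).

Definition Lambda_factor (q : nat) (i : 'I_n) : D -> Prop :=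
  lin_span (fun u => exists j : nat, u = dpow K i (j * q)).

(* The tensor product of subalgebras C_i of the factors D(K[x_i]), as a
   subspace of D(P_n). *)
Definition tensor_subalg (C : 'I_n -> D -> Prop) : D -> Prop :=
  lin_span (fun u => exists2 a : 'I_n -> D,
    (forall i, C i (a i)) & u = \prod_(i < n) a i).

(* The permutation sigma sends the slots of P_s (x) Lambda (x) ... (x) Lambda
   to the tensor factors of D(P_n). *)
Definition has_type (p s : nat) (k : (n - s).-tuple nat)
    (L : subalgClosed D) : Prop :=
  exists sigma : 'S_n, forall u : D, u \in L <->
    tensor_subalg (fun i =>
      let j := (sigma^-1)%g i in
      if (j < s)%N then P_factor i
      else Lambda_factor (p ^ nth 0%N k (j - s)) i) u.

End Types.

(* Main.v *)
(* Choose a maximal set S of variables such that K[x_S] acts freely on some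
   element of M, and let T be the K[x_S]-torsion of M. By maximality every
   element is killed by a nonzero polynomial in x_i over K[x_S], for each i not
   in S. Fix such an i and choose k and a polynomial g of least degree such that
   g(x_i^q), q = p^k, kills modulo T some element outside T. Minimality forces
   g' <> 0 (otherwise g would be a polynomial in a p-th power) and makes every
   nonzero polynomial in x_i^q of smaller degree injective modulo T. Let N'
   consist of the elements killed modulo T by g(x_i^q) and by the d_i^[b],
   0 < b < q. Since [d_i^[jq], x_i^q] = d_i^[(j-1)q], applying g(x_i^q) to a
   relation sum_j d_i^[jq] w_j in T with w_j in N' replaces its leading
   coefficient w_J by -g'(x_i^q) w_J in degree J - 1; so all w_j are in T by
   induction, and applying d_i^[b], b < q, separates the terms x_i^b w_j. As N'
   is stable under the operators in the other variables, iterating over i gives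
   an element v such that V is spanned by the x^b v, b_i < p^(k_i). *)

Require Import Defs.
From HB Require Import structures.
From mathcomp Require Import all_boot perm all_algebra generic_quotient.
From mathcomp Require Import mpoly boolp zify.

Set Implicit Arguments.
Unset Strict Implicit.
Unset Printing Implicit Defensive.

Import GRing.Theory.
Local Open Scope ring_scope.

(** * Binomial coefficients divisible by p *)

(** With q = p^k one has a C(q, a) = q C(q-1, a-1); if p did not divide C(q, a), then q would divide
    a, which is impossible for 0 < a < q. *)
Lemma prime_dvd_bin_exp p k a :
  prime p -> (0 < a < p ^ k)%N -> (p %| 'C(p ^ k, a))%N.
Proof.
move=> p_pr /andP[a_gt0 lt_aq]; apply: contraLR lt_aq => pNC.
have := mul_bin_diag (p ^ k) a.-1; rewrite prednK // => eqC.
rewrite -leqNgt dvdn_leq // -(@Gauss_dvdl (p ^ k) a 'C(p ^ k, a)).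
  by rewrite -eqC dvdn_mulr.
by rewrite coprimeXl // prime_coprime.
Qed.

(** Write a + b = p^k + c with c < a and expand by Vandermonde: the term of index 0 contains C(c, a)
    = 0, and every other term contains some C(p^k, i) with 0 < i < p^k. *)
Lemma prime_dvd_bin_carry p k a b : prime p ->
  (a < p ^ k)%N -> (b < p ^ k)%N -> (p ^ k <= a + b)%N -> (p %| 'C(a + b, a))%N.
Proof.
move=> p_pr lt_a lt_b le_ab; rewrite -(subnKC le_ab) -binomial.Vandermonde.
apply: (big_ind (fun m => (p %| m)%N)) => [|x y|i _]; [exact: dvdn0|exact: dvdn_add|].
have [i0|i_gt0] := posnP i; last first.
  by rewrite dvdn_mulr // prime_dvd_bin_exp // i_gt0 (leq_ltn_trans _ lt_a) // -ltnS.
by rewrite i0 subn0 [X in (_ * X)%N]bin_small ?muln0 //; lia.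
Qed.

(** * Additive subgroups of a module and the operators preserving them *)

Section Stability.
Variables (A : pzRingType) (M : lmodType A).
Implicit Types (N : M -> Prop) (u : A).

Definition subgroup N := N 0 /\ forall x y, N x -> N y -> N (x - y).
Definition stable u N := forall x, N x -> N (u *: x).

Lemma subgroupN N x : subgroup N -> N x -> N (- x).
Proof. by case=> N0 NB Nx; rewrite -sub0r; exact: NB. Qed.

Lemma subgroupD N x y : subgroup N -> N x -> N y -> N (x + y).
Proof.
move=> sN Nx Ny; rewrite -[y]opprK; apply: sN.2 => //.
exact: subgroupN.
Qed.

Lemma subgroupDl N x y : subgroup N -> N x -> N (x + y) -> N y.
Proof. by move=> sN Nx /sN.2/(_ Nx); rewrite addrC addKr. Qed.

Lemma subgroupDr N x y : subgroup N -> N y -> N (x + y) -> N x.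
Proof. by move=> sN Ny; rewrite addrC; exact: subgroupDl. Qed.

Lemma subgroup_sum N (I : eqType) (r : seq I) (P : pred I) (F : I -> M) :
  subgroup N -> (forall i, i \in r -> P i -> N (F i)) -> N (\sum_(i <- r | P i) F i).
Proof.
move=> sN NF; rewrite big_seq_cond; apply: (big_ind N) => [|x y|i].
- exact: sN.1.
- exact: subgroupD.
- by case/andP; exact: NF.
Qed.

Lemma subgroupMn N x n : subgroup N -> N x -> N (x *+ n).
Proof.
move=> sN Nx; elim: n => [|n IH]; first by rewrite mulr0n; exact: sN.1.
by rewrite mulrS; exact: subgroupD.
Qed.

Lemma stable1 N : stable 1 N.
Proof. by move=> x; rewrite scale1r. Qed.

Lemma stableM u v N : stable u N -> stable v N -> stable (u * v) N.
Proof. by move=> su sv x Nx; rewrite -scalerA; exact/su/sv. Qed.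

Lemma stableX u n N : stable u N -> stable (u ^+ n) N.
Proof.
move=> su; elim: n => [|n IH]; first by rewrite expr0; exact: stable1.
by rewrite exprS; exact: stableM.
Qed.

Lemma stable_sum N (I : eqType) (r : seq I) (P : pred I) (F : I -> A) :
  subgroup N -> (forall i, i \in r -> P i -> stable (F i) N) ->
  stable (\sum_(i <- r | P i) F i) N.
Proof.
by move=> sN sF x Nx; rewrite scaler_suml; apply: subgroup_sum => // i ri Pi; exact: sF.
Qed.

Lemma stable_prod N (I : eqType) (r : seq I) (P : pred I) (F : I -> A) :
  (forall i, i \in r -> P i -> stable (F i) N) -> stable (\prod_(i <- r | P i) F i) N.
Proof.
move=> sF; rewrite big_seq_cond; apply: (big_ind (fun u => stable u N)) => [|x y|i].
- exact: stable1.
- exact: stableM.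
- by case/andP; exact: sF.
Qed.

End Stability.

(** * Evaluation of polynomials over a noncommutative ring *)

Lemma stable_horner (A : nzRingType) (M : lmodType A) (N : M -> Prop)
    (g : {poly A}) (Y : A) :
  subgroup N -> (forall i, stable g`_i N) -> stable Y N -> stable g.[Y] N.
Proof.
move=> sN sg sY; rewrite horner_coef; apply: stable_sum => // i _ _.
by apply: stableM; [exact: sg|exact: stableX].
Qed.

Lemma comm_horner (A : nzRingType) (g : {poly A}) (Y u : A) :
  (forall i, GRing.comm u g`_i) -> GRing.comm u Y -> GRing.comm u g.[Y].
Proof.
move=> ug uY; rewrite horner_coef; apply: commr_sum => i _.
by apply: commrM => //; exact: commrX.
Qed.

Lemma horner_decimate (A : nzRingType) (g : {poly A}) (Y : A) p : (0 < p)%N ->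
  (forall i, ~~ (p %| i)%N -> g`_i = 0) ->
  (\poly_(i < size g) g`_(i * p)).[Y ^+ p] = g.[Y].
Proof.
move=> p_gt0 g0; rewrite horner_poly.
(* Padding the evaluation of g with zero coefficients cuts it into [size g] blocks of length p, and
   only the first term of each block survives. *)
have le_g : (size g <= size g * p)%N by rewrite leq_pmulr.
rewrite (horner_coef_wide _ le_g).
have dec N : \sum_(0 <= i < N) g`_(i * p) * (Y ^+ p) ^+ i =
    \sum_(0 <= i < N * p) g`_i * Y ^+ i.
  elim: N => [|N IH]; first by rewrite mul0n !big_geq.
  rewrite big_nat_recr //= IH mulSn addnC.
  rewrite [RHS](@big_cat_nat _ _ _ (N * p)) ?leq_addr //=; congr (_ + _).
  rewrite big_ltn ?addnS ?big1_seq ?addr0 -?exprM 1?mulnC //; last by lia.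
  move=> i; rewrite mem_index_iota => /andP[_ /andP[lt_i gt_i]].
  rewrite g0 ?mul0r //; apply/negP => /dvdnP[j ij]; move: lt_i gt_i.
  rewrite ij -mulnSr [(j * p)%N]mulnC !ltn_pmul2l // => lt_Nj.
  by rewrite ltnS leqNgt lt_Nj.
by have := dec (size g); rewrite !big_mkord.
Qed.

(** * One variable X with its divided powers, in an abstract algebra *)

Section DividedPowers.
Variables (K : fieldType) (p : nat) (A : algType K) (X : A) (d : nat -> A).
Hypothesis pcharKp : p \in [pchar K].
Hypothesis d0 : d 0 = 1.
Hypothesis dM : forall a b, d a * d b = d (a + b) *+ 'C(a + b, a).
Hypothesis dSX : forall j, d j.+1 * X = X * d j.+1 + d j.

Let p_pr : prime p := pcharf_prime pcharKp.

Lemma mulrn_pchar_dvd (u : A) m : (p %| m)%N -> u *+ m = 0.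
Proof.
by rewrite (dvdn_pcharf pcharKp) -scaler_nat => /eqP ->; rewrite scale0r.
Qed.

Lemma pchar_exp_gt0 k : (0 < p ^ k)%N.
Proof. by rewrite expn_gt0 prime_gt0. Qed.

Lemma comm_dpow a b : GRing.comm (d a) (d b).
Proof.
rewrite /GRing.comm !dM [(b + a)%N]addnC; congr (_ *+ _).
by rewrite -[LHS]bin_sub ?leq_addr // addKn.
Qed.

(* The divided power d (j - a), read as 0 when j < a. *)
Definition dsub a j : A := if (a <= j)%N then d (j - a) else 0.

Lemma dsubX a j : dsub a j * X = X * dsub a j + dsub a.+1 j.
Proof.
rewrite /dsub; have [lt_aj|lt_ja|->] := ltngtP a j.
- by rewrite -(subnSK lt_aj) dSX.
- by rewrite mul0r mulr0 addr0.
- by rewrite subnn d0 mul1r mulr1 addr0.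
Qed.

(** Leibniz' rule. By [dsubX], each passage across a factor X either keeps the operator or lowers
    its index by one; Pascal's rule counts the ways to lower it b times. The offset a is kept
    general for the induction. *)
Lemma dsubXn m a j :
  dsub a j * X ^+ m = \sum_(b < m.+1) (X ^+ (m - b) * dsub (a + b) j) *+ 'C(m, b).
Proof.
elim: m a => [|m IH] a.
  by rewrite big_ord1 expr0 mulr1 mul1r addn0.
rewrite exprS mulrA dsubX mulrDl -mulrA !IH [RHS]big_ord_recl /=.
under [in RHS]eq_bigr => b _ do rewrite binS mulrnDr subSS.
rewrite big_split /= addrA; congr (_ + _); last first.
  by apply: eq_bigr => b _; rewrite addnS addSn.
rewrite [in RHS]big_ord_recr /= (@bin_small m m.+1) // mulr0n addr0.
rewrite [in LHS]big_ord_recl mulrDr !bin0 mulrA -exprS /= !subn0; congr (_ + _).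
rewrite mulr_sumr; apply: eq_bigr => b _.
by rewrite mulrnAr mulrA -exprS /bump /= -subSn.
Qed.

Lemma dpowXn m j :
  d j * X ^+ m = \sum_(b < m.+1) (X ^+ (m - b) * dsub b j) *+ 'C(m, b).
Proof. by have := dsubXn m 0 j; rewrite {1}/dsub subn0. Qed.

(* The intermediate binomials in Leibniz' rule vanish mod p. *)
Lemma dpowXq k j :
  d j * X ^+ (p ^ k) = X ^+ (p ^ k) * d j + dsub (p ^ k) j.
Proof.
have q_gt0 := pchar_exp_gt0 k.
rewrite dpowXn (bigD1 ord0) //= (bigD1 ord_max) //=; last first.
  by rewrite -val_eqE /= -lt0n.
rewrite bin0 binn subn0 subnn mul1r {1}/dsub subn0.
rewrite big1 ?addr0 // => b /andP[]; rewrite -!val_eqE /= => b_neq0 b_neqq.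
rewrite mulrn_pchar_dvd // prime_dvd_bin_exp // lt0n b_neq0.
by rewrite ltn_neqAle b_neqq -ltnS ltn_ord.
Qed.

Lemma dpow_mulSq k j :
  d (j.+1 * p ^ k) * X ^+ (p ^ k) = X ^+ (p ^ k) * d (j.+1 * p ^ k) + d (j * p ^ k).
Proof. by rewrite dpowXq /dsub mulSn leq_addr addKn. Qed.

Lemma comm_dpow_small k b : (b < p ^ k)%N -> GRing.comm (d b) (X ^+ (p ^ k)).
Proof. by move=> lt_bq; rewrite /GRing.comm dpowXq /dsub leqNgt lt_bq addr0. Qed.

Lemma dpowM_carry k a b :
  (a < p ^ k)%N -> (b < p ^ k)%N -> (p ^ k <= a + b)%N -> d a * d b = 0.
Proof. by move=> *; rewrite dM mulrn_pchar_dvd // (@prime_dvd_bin_carry _ k). Qed.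

(** In the application R is the image of K[x_S], T is the K[x_S]-torsion of M, and N is the subgroup
    left by the variables already treated. *)
Variables (M : lmodType A) (R : A -> Prop) (T N : M -> Prop).
Hypothesis RMn : forall n r, R r -> R (r *+ n).
Hypothesis R0 : R 0.
Hypothesis RC : forall r r', R r -> R r' -> GRing.comm r r'.
Hypothesis RX : forall r, R r -> GRing.comm r X.
Hypothesis Rd : forall r j, R r -> GRing.comm r (d j).
Hypothesis sT : subgroup T.
Hypothesis sN : subgroup N.
Hypothesis TR : forall r, R r -> stable r T.
Hypothesis NR : forall r, R r -> stable r N.
Hypothesis TX : stable X T.
Hypothesis NX : stable X N.
Hypothesis Td : forall j, stable (d j) T.
Hypothesis Nd : forall j, stable (d j) N.
Hypothesis T_saturated : forall r m, R r -> r != 0 -> T (r *: m) -> T m.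

(** * Independence of the d_(jq) X^i over the slice cut out by a minimal g *)

Section MinimalAnnihilator.
Variables (k : nat) (g : {poly A}).
Hypothesis Rg : forall i, R g`_i.
Let q := (p ^ k)%N.
Let Y := X ^+ q.
Hypothesis dg_neq0 : g^`() != 0.
Hypothesis small_injective : forall (h : {poly A}) w,
  (forall i, R h`_i) -> h != 0 -> (size h < size g)%N -> N w -> T (h.[Y] *: w) -> T w.

(** This is the N' of the overview. Modulo T its elements behave as constants for the d_b with 0 < b
    < q, which later separates the multiples X^i w. *)
Definition slice w :=
  [/\ N w, T (g.[Y] *: w) & forall b, (0 < b < q)%N -> T (d b *: w)].

Lemma subgroup_slice : subgroup slice.
Proof.
split; first by split=> [||b _]; rewrite ?scaler0 //; first [exact: sN.1|exact: sT.1].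
move=> x y [Nx gx dx] [Ny gy dy]; split=> [||b lt_b].
- exact: sN.2.
- by rewrite scalerBr; exact: sT.2.
- by rewrite scalerBr; apply: sT.2; [exact: dx|exact: dy].
Qed.

Lemma stable_slice u :
  GRing.comm u X -> (forall j, GRing.comm u (d j)) -> (forall r, R r -> GRing.comm u r) ->
  stable u T -> stable u N -> stable u slice.
Proof.
move=> uX ud uR uT uN w [Nw gw dw]; split=> [||b lt_b].
- exact: uN.
- rewrite scalerA -comm_horner; [|by move=> i; exact: uR|exact: commrX].
  by rewrite -scalerA; exact: uT.
- by rewrite scalerA -ud -scalerA; exact/uT/dw.
Qed.

Let NY : stable Y N := stableX q NX.
Let TY : stable Y T := stableX q TX.

Lemma slice_Y : stable Y slice.
Proof.
move=> w [Nw gw dw]; split=> [||b lt_b].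
- exact: NY.
- rewrite scalerA -comm_horner; [|by move=> i; exact/commr_sym/commrX/RX|by []].
  by rewrite -scalerA; exact: TY.
- rewrite scalerA comm_dpow_small; last by case/andP: lt_b.
  by rewrite -scalerA; exact/TY/dw.
Qed.

Lemma slice_R r : R r -> stable r slice.
Proof.
move=> Rr; apply: stable_slice; [exact: RX|by move=> j; exact: Rd| |exact: TR|exact: NR].
by move=> r'; exact: RC.
Qed.

Lemma slice_poly (h : {poly A}) : (forall i, R h`_i) -> stable h.[Y] slice.
Proof.
move=> Rh; apply: (stable_horner _ _ slice_Y); first exact: subgroup_slice.
by move=> i; exact: slice_R.
Qed.

(* Sums of the d_(j q) w_j with j < J and w_j in the slice, modulo T. *)
Fixpoint layer J (x : M) : Prop :=
  if J is J'.+1 then exists2 w, slice w & layer J' (x - d (J' * q) *: w) else T x.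

Lemma subgroup_layer J : subgroup (layer J).
Proof.
elim: J => [|J [L0 LB]] //=; split.
  by exists 0; [exact: subgroup_slice.1|rewrite scaler0 subr0].
move=> x y [v sv Lx] [w sw Ly]; exists (v - w); first exact: subgroup_slice.2.
have := LB _ _ Lx Ly; rewrite scalerBr !opprB addrACA [- _ - y]addrC -addrACA; exact.
Qed.

Lemma layerS J x : layer J x -> layer J.+1 x.
Proof. by exists 0; [exact: subgroup_slice.1|rewrite scaler0 subr0]. Qed.

Lemma layer_T J x : T x -> layer J x.
Proof. by move=> Tx; elim: J => // J; exact: layerS. Qed.

Lemma layer_dpow J w : slice w -> layer J.+1 (d (J * q) *: w).
Proof. by move=> sw; exists w => //; rewrite subrr; exact: (subgroup_layer J).1. Qed.

Lemma layer_R J r : R r -> stable r (layer J).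
Proof.
move=> Rr; elim: J => [|J IH] x /=; first exact: TR.
case=> w sw Lw; exists (r *: w); first exact: slice_R.
by rewrite scalerA -Rd // -scalerA -scalerBr; exact: IH.
Qed.

Lemma commutator_layer J w : slice w ->
  layer J (d (J * q) *: (Y *: w) - Y *: (d (J * q) *: w)).
Proof.
move=> sw; case: J => [|J].
  by rewrite mul0n d0 !scale1r subrr; exact: sT.1.
by rewrite !scalerA -scalerBl dpow_mulSq addrC addKr; exact: layer_dpow.
Qed.

Lemma layer_Y J : stable Y (layer J).
Proof.
elim: J => [|J IH] x /=; first exact: TY.
case=> w sw /IH Lw; exists (Y *: w); first exact: slice_Y.
have := (subgroup_layer J).2 _ _ Lw (commutator_layer J sw).
by rewrite scalerBr opprB addrA subrK.
Qed.

(** Commuting with d_((J+1)q) differentiates Y^a to first order, because the commutator with Y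
    itself is d_(Jq). The second-order terms have index below J and disappear in [layer J]. *)
Lemma Yn_dpow a J w : slice w ->
  layer J (Y ^+ a *: (d (J.+1 * q) *: w) - d (J.+1 * q) *: (Y ^+ a *: w) +
           d (J * q) *: ((Y ^+ a.-1 *: w) *+ a)).
Proof.
move=> sw; elim: a => [|a IH].
  rewrite !expr0 !scale1r subrr mulr0n scaler0 add0r.
  exact: (subgroup_layer J).1.
have sYw : slice ((Y ^+ a.-1 *: w) *+ a).
  by apply: subgroupMn; [exact: subgroup_slice|exact: (stableX a.-1 slice_Y)].
have := subgroupD (subgroup_layer J) (layer_Y IH) (commutator_layer J sYw).
(* For a = 0 the truncated exponent [a.-1] is harmless, since the multiple is zero. *)
rewrite (_ : Y *: (_ *+ a) = (Y ^+ a *: w) *+ a); last first.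
  case: a {IH sYw} => [|a]; first by rewrite !mulr0n scaler0.
  by rewrite -scalerMnr scalerA -exprS.
rewrite scalerDr scalerBr addrA -addrA addrCA addrK; congr (layer J).
have -> : Y *: (d (J.+1 * q) *: (Y ^+ a *: w)) =
    d (J.+1 * q) *: (Y ^+ a.+1 *: w) - d (J * q) *: (Y ^+ a *: w).
  by rewrite !scalerA exprS mulrA dpow_mulSq mulrDl scalerDl -!mulrA addrK.
rewrite [Y *: (Y ^+ a *: _)]scalerA -exprS opprB /= mulrS scalerDr.
by rewrite addrC [RHS]addrA; congr (_ + _); rewrite addrA addrAC.
Qed.

Lemma deriv_wide n : (size g <= n)%N ->
  g^`().[Y] = \sum_(a < n) (g`_a * Y ^+ a.-1) *+ a.
Proof.
case: n => [|n] le_gn.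
  by move: dg_neq0; rewrite -size_poly_leq0 (leq_trans (size_poly _ _)) //; lia.
rewrite big_ord_recl mulr0n add0r (@horner_coef_wide _ n); last first.
  by rewrite -ltnS; apply: leq_trans le_gn; rewrite lt_size_deriv //;
     apply: contraNneq dg_neq0 => ->; rewrite deriv0.
by apply: eq_bigr => a _; rewrite coef_deriv mulrnAl.
Qed.

(** Summing [Yn_dpow] against the coefficients of g, which commute with d, assembles the terms a
    Y^(a-1) into g'(Y). The remaining term d(g(Y) w) is in T because g(Y) w is. *)
Lemma annihilator_dpow J w : slice w ->
  layer J (g.[Y] *: (d (J.+1 * q) *: w) + d (J * q) *: (g^`().[Y] *: w)).
Proof.
move=> sw; have [Nw gw dw] := sw.
have Lsum : layer J (\sum_(a < size g) g`_a *:
    (Y ^+ a *: (d (J.+1 * q) *: w) - d (J.+1 * q) *: (Y ^+ a *: w) +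
     d (J * q) *: ((Y ^+ a.-1 *: w) *+ a))).
  apply: subgroup_sum => [|a _ _]; first exact: subgroup_layer.
  by apply: (layer_R (Rg a)); exact: Yn_dpow.
have LT : layer J (d (J.+1 * q) *: (g.[Y] *: w)) by exact/layer_T/Td.
have := subgroupD (subgroup_layer J) Lsum LT.
rewrite (deriv_wide (leqnn _)) horner_coef !scaler_suml !scaler_sumr -!big_split /=.
congr (layer J); apply: eq_bigr => a _.
rewrite scalerDr scalerBr -!scalerA [g`_a *: (d _ *: (Y ^+ a *: _))]scalerA.
rewrite Rd // -scalerA addrAC subrK; congr (_ + _).
by rewrite scalerA Rd // -scalerA -scalerMnr -scalerMnl scalerA.
Qed.

(** Each term d_(jq) w becomes, up to lower layers, a term of index j - 1 with coefficient -g'(Y) w,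
    again in the slice; the term of index 0 goes into T. *)
Lemma annihilator_layer J x : layer J.+1 x -> layer J (g.[Y] *: x).
Proof.
elim: J x => [|J IH] x [w sw Lx].
  have [Nw gw dw] := sw.
  rewrite mul0n d0 scale1r in Lx; rewrite /= -(subrK w x) scalerDr.
  apply: subgroupD => //; move: (_ - _) Lx => t Tt.
  apply: (stable_horner sT _ TY) => // i; exact: TR.
rewrite -(subrK (d (J.+1 * q) *: w) x) scalerDr.
apply: subgroupD; [exact: subgroup_layer|exact/layerS/IH|].
apply: (subgroupDr (subgroup_layer J.+1) _ (layerS (annihilator_dpow J sw))).
by apply: layer_dpow; apply: slice_poly sw => i; rewrite coef_deriv; exact: RMn.
Qed.

(* Applying g(Y) to a relation shortens it and multiplies its leading
   coefficient by -g'(Y), which is injective modulo T by minimality of g. *)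
Lemma layer_lead J w l : slice w -> layer J l -> T (d (J * q) *: w + l) -> T w.
Proof.
elim: J w l => [|J IH] w l sw Ll.
  by rewrite mul0n d0 scale1r; exact: subgroupDr.
have Rdg i : R g^`()`_i by rewrite coef_deriv; exact: RMn.
have sdw : slice (g^`().[Y] *: w) by exact: slice_poly.
move=> /(stable_horner sT (fun i => TR (Rg i)) TY); rewrite scalerDr => Tgx.
have [Nw _ _] := sw; apply: (small_injective Rdg dg_neq0 _ Nw).
  by apply: lt_size_deriv; apply: contraNneq dg_neq0 => ->; rewrite deriv0.
have Ll' := subgroupD (subgroup_layer J) (annihilator_dpow J sw) (annihilator_layer Ll).
apply: (IH _ _ sdw (subgroupN (subgroup_layer J) Ll')).
rewrite -opprB; apply: subgroupN => //.
by rewrite addrAC addrK.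
Qed.

Lemma layer_sum J (w : nat -> M) : (forall j, slice (w j)) ->
  layer J (\sum_(j < J) d (j * q) *: w j).
Proof.
move=> sw; elim: J => [|J IH]; first by rewrite big_ord0; exact: sT.1.
by rewrite big_ord_recr /=; exists (w J) => //; rewrite addrK.
Qed.

Lemma slice_independent J (w : nat -> M) : (forall j, slice (w j)) ->
  T (\sum_(j < J) d (j * q) *: w j) -> forall j, (j < J)%N -> T (w j).
Proof.
move=> sw; elim: J => // J IH; rewrite big_ord_recr /= addrC => Tx.
have TwJ : T (w J) by apply: layer_lead Tx => //; exact: layer_sum.
move=> j; rewrite ltnS leq_eqVlt => /orP[/eqP-> //|]; apply: IH.
by apply: subgroupDl Tx => //; exact: Td.
Qed.

(** In Leibniz' expansion the term of index c applies d_(b-c) to w. For c < b this lies in T since 0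
    < b - c < q, so only c = b, hence i = b, can contribute. *)
Lemma dpow_slice b i w : (b < q)%N -> (i <= b)%N -> slice w ->
  T (d b *: (X ^+ i *: w) - w *+ (i == b)).
Proof.
move=> lt_bq le_ib [Nw _ dw].
have dsub_T c : (c <= i)%N -> T ((dsub c b - (c == b)%:R) *: w).
  move=> le_ci; rewrite /dsub (leq_trans le_ci le_ib).
  have [->|neq_cb] := eqVneq c b; first by rewrite subnn d0 subrr scale0r; exact: sT.1.
  by rewrite subr0; apply: dw; lia.
rewrite scalerA dpowXn scaler_suml.
(* The expected value is written as a Leibniz sum of the same shape, so that the difference is taken
   term by term. *)
have -> : w *+ (i == b) =
    \sum_(c < i.+1) ((X ^+ (i - c) * (c == b :> nat)%:R) *+ 'C(i, c)) *: w.
  rewrite big_ord_recr big1 /= ?add0r => [|c _]; last first.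
    by rewrite ltn_eqF ?mulr0 ?mul0rn ?scale0r // (leq_trans _ le_ib).
  by rewrite subnn mul1r binn mulr1n; case: (i == b); rewrite ?scale1r ?scale0r.
rewrite -sumrB; apply: subgroup_sum => // c _ _.
rewrite -!scalerMnl -mulrnBl; apply: subgroupMn => //.
rewrite -scalerBl -mulrBr -scalerA; apply: (stableX (i - c) TX).
by apply: dsub_T; rewrite -ltnS.
Qed.

(** If I is the top exponent of X, applying d_I kills the lower powers modulo T and turns X^I w into
    w, while commuting with the d_(jq). Then [slice_independent] puts the top coefficients in T, and
    the exponent bound drops. *)
Lemma slice_independentX J (w : nat -> nat -> M) : (forall j i, slice (w j i)) ->
  T (\sum_(j < J) \sum_(i < q) d (j * q) *: (X ^+ i *: w j i)) ->
  forall j i, (j < J)%N -> (i < q)%N -> T (w j i).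
Proof.
move=> sw Tx j i lt_jJ; suff T_upto I : (I <= q)%N ->
    T (\sum_(j < J) \sum_(i < I) d (j * q) *: (X ^+ i *: w j i)) ->
    (i < I)%N -> T (w j i) by exact: T_upto (leqnn q) Tx.
elim: I {Tx} => // I IH lt_Iq Tx.
have TwI j' : (j' < J)%N -> T (w j' I).
  apply: (slice_independent (w := fun j => w j I)) => //.
  have := Td I Tx; rewrite scaler_sumr => TdIx.
  apply: (subgroupDr sT _ (_ : T (_ + \sum_(j < J)
    (d I *: (\sum_(i < I.+1) d (j * q) *: (X ^+ i *: w j i)) - d (j * q) *: w j I)))).
    apply: subgroup_sum => // j'' _ _.
    rewrite scaler_sumr big_ord_recr /= -addrA.
    apply: subgroupD => //; [apply: subgroup_sum => // c _ _|].
      rewrite scalerA comm_dpow -scalerA; apply: Td.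
      have := dpow_slice lt_Iq (ltnW (ltn_ord c)) (sw j'' c).
      by rewrite ltn_eqF // subr0.
    rewrite scalerA comm_dpow -scalerA -scalerBr; apply: Td.
    by have := dpow_slice lt_Iq (leqnn I) (sw j'' I); rewrite eqxx.
  by rewrite sumrB addrC subrK.
rewrite ltnS leq_eqVlt => /orP[/eqP -> | lt_iI]; first exact: TwI.
apply: IH lt_iI; first exact: ltnW.
apply: (subgroupDr sT _ (_ : T (_ + \sum_(j < J) d (j * q) *: (X ^+ I *: w j I)))).
  apply: subgroup_sum => // j' _ _; apply/Td/(stableX I TX)/TwI; exact: ltn_ord.
by move: Tx; congr T; rewrite -big_split; apply: eq_bigr => j' _; rewrite big_ord_recr.
Qed.

End MinimalAnnihilator.

(** * Choice of k and of the minimal annihilator g *)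

Lemma mulrn_eq0_pchar (u : A) n : ~~ (p %| n)%N -> u *+ n = 0 -> u = 0.
Proof.
rewrite (dvdn_pcharf pcharKp) => n_neq0 /eqP.
by rewrite -scaler_nat scaler_eq0 (negbTE n_neq0) => /eqP.
Qed.

(** A zero derivative forces p to divide the degree l of g, so the leading coefficient survives at
    index l / p; the size drops because l > 0 and p > 1. *)
Lemma size_decimate (g : {poly A}) : (1 < size g)%N -> g^`() = 0 ->
  let g' := \poly_(i < size g) g`_(i * p) in g' != 0 /\ (size g' < size g)%N.
Proof.
move=> size_g dg0 g'; set l := (size g).-1.
have p_gt1 : (1 < p)%N by exact: prime_gt1.
have g_l : g`_l != 0 by rewrite -/(lead_coef g) lead_coef_eq0 -size_poly_gt0 ltnW.
have p_l : (p %| l)%N.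
  apply: contraNT g_l => p'l; apply/eqP/(mulrn_eq0_pchar p'l).
  by have := coef_deriv g l.-1; rewrite dg0 coef0 prednK //; lia.
split.
  apply: contraNneq g_l => g'0; have := coef_poly (size g) (fun i => g`_(i * p)) (l %/ p).
  rewrite -/g' g'0 coef0 divnK // ifT // => [<-//|].
  by apply: leq_ltn_trans (leq_div _ _) _; lia.
suff : (size g' <= l)%N by rewrite /l; lia.
apply/leq_sizeP => j le_lj; rewrite coef_poly; case: ifP => // _.
apply: nth_default; have : (j * 2 <= j * p)%N by rewrite leq_mul2l p_gt1 orbT.
move: le_lj size_g; rewrite /l /g'; move: (size g) => sg. lia.
Qed.

Hypothesis N_torsion : forall m, N m ->
  exists g : {poly A}, [/\ forall i, R g`_i, g != 0 & T (g.[X] *: m)].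
Hypothesis N_T : exists2 m, N m & ~ T m.

(** The size of g is minimised over all k at once, so that k may be raised when g is a polynomial in
    a p-th power. The stability clause allows the construction to be repeated inside N' for the
    other variables. *)
Lemma one_variable : exists (k : nat) (N' : M -> Prop),
  [/\ subgroup N', exists2 m, N' m & ~ T m,
      forall u, GRing.comm u X -> (forall j, GRing.comm u (d j)) ->
        (forall r, R r -> GRing.comm u r) -> stable u T -> stable u N -> stable u N',
      forall x, N' x -> N x
    & forall J (w : nat -> nat -> M), (forall j i, N' (w j i)) ->
        T (\sum_(j < J) \sum_(i < p ^ k) d (j * p ^ k) *: (X ^+ i *: w j i)) ->
        forall j i, (j < J)%N -> (i < p ^ k)%N -> T (w j i)].
Proof.
pose bad n := `[< exists k (g : {poly A}) m,
  [/\ forall i, R g`_i, g != 0 & size g = n] /\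
  [/\ N m, ~ T m & T (g.[X ^+ (p ^ k)] *: m)] >].
have ex_bad : exists n, bad n.
  have [m Nm Tm] := N_T; have [g [Rg g0 Tg]] := N_torsion Nm.
  by exists (size g); apply/asboolP; exists 0, g, m; split; split=> //; rewrite expn0 expr1.
have [n /asboolP[k [g [m [[Rg g_neq0 <-] [Nm Tm Tgm]]]]] min_g] := ex_minnP ex_bad.
pose q := (p ^ k)%N.
have small (h : {poly A}) w : (forall i, R h`_i) -> h != 0 -> (size h < size g)%N -> N w ->
    T (h.[X ^+ q] *: w) -> T w.
  move=> Rh h0 lt_hg Nw Tw; apply: contrapT => Tw'.
  suff /min_g : bad (size h) by rewrite leqNgt lt_hg.
  by apply/asboolP; exists k, h, w.
(* A constant g would be a nonzero element of R carrying m into T, against saturation. *)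
have size_g : (1 < size g)%N.
  rewrite ltn_neqAle size_poly_gt0 g_neq0 andbT eq_sym; apply/negP => /size_poly1P[c c0 gc].
  apply: Tm; apply: (T_saturated (r := c)) => //; last by rewrite gc hornerC in Tgm.
  by have := Rg 0; rewrite gc coefC.
(* Otherwise g(X^q) is a shorter polynomial evaluated at X^(pq), which contradicts minimality with k
   + 1 in place of k. *)
have dg_neq0 : g^`() != 0.
  apply/eqP => dg0; have [g'0] := size_decimate size_g dg0; rewrite ltnNge => /negP; apply.
  apply: min_g; apply/asboolP; exists k.+1, (\poly_(i < size g) g`_(i * p)), m.
  split; split=> //; first by move=> i; rewrite coef_poly; case: ifP.
  rewrite expnSr exprM horner_decimate ?prime_gt0 // => i p'i.
  case: i p'i => [|i] p'i; first by rewrite dvdn0 in p'i.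
  by apply: (mulrn_eq0_pchar p'i); rewrite -coef_deriv dg0 coef0.
exists k, (slice k g); split.
- exact: subgroup_slice.
(* The witness is d_e m with e < q largest such that it is outside T. For 0 < b < q, d_b d_e is a
   multiple of d_(b+e): if b + e < q maximality applies, otherwise the carry makes the product
   zero. *)
- pose nz e := (e < q)%N && `[< ~ T (d e *: m) >].
  have ex_e : exists e, nz e.
    by exists 0; rewrite /nz pchar_exp_gt0; apply/asboolP; rewrite d0 scale1r.
  have ub_e e : nz e -> (e <= q)%N by case/andP=> /ltnW.
  have [e /andP[lt_eq /asboolP Tem] max_e] := ex_maxnP ex_e ub_e.
  exists (d e *: m) => //; split=> [||b /andP[b_gt0 lt_bq]].
  + exact: Nd.
  + rewrite scalerA -comm_horner => [|i|]; last exact: comm_dpow_small.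
      by rewrite -scalerA; exact: Td.
    exact/commr_sym/Rd.
  rewrite scalerA; have [le_q|lt_q] := leqP q (b + e).
    by rewrite (dpowM_carry lt_bq lt_eq le_q) scale0r; exact: sT.1.
  rewrite dM -scalerMnl; apply: subgroupMn => //; apply: contrapT => Tbe.
  suff /max_e : nz (b + e)%N by rewrite -{2}(add0n e) leq_add2r leqNgt b_gt0.
  by rewrite /nz lt_q; exact/asboolP.
- by move=> u *; apply: stable_slice.
- by move=> x [].
- by move=> J w sw Tx j i; exact: (slice_independentX Rg dg_neq0 small sw Tx).
Qed.

End DividedPowers.

(** * Multiplication operators form a copy of the polynomial ring *)

Lemma mulop_is_zmod_morphism (K : fieldType) (S : comAlgType K) :
  zmod_morphism (@mulop K S).
Proof.
move=> r s; apply: diffop_eq => f; transitivity (r * f + (-1) * (s * f)) => //.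
by rewrite mulN1r mulopE mulrBl.
Qed.

Lemma mulop_is_monoid_morphism (K : fieldType) (S : comAlgType K) :
  monoid_morphism (@mulop K S).
Proof. by split=> // r s; apply: diffop_eq => f; rewrite diffop_mulE !mulopE mulrA. Qed.

HB.instance Definition _ (K : fieldType) (S : comAlgType K) :=
  GRing.isZmodMorphism.Build S (diffop S) (@mulop K S) (@mulop_is_zmod_morphism K S).
HB.instance Definition _ (K : fieldType) (S : comAlgType K) :=
  GRing.isMonoidMorphism.Build S (diffop S) (@mulop K S) (@mulop_is_monoid_morphism K S).

Lemma mulopZ (K : fieldType) (S : comAlgType K) (c : K) (r : S) :
  mulop (c *: r) = c *: mulop r.
Proof. by apply: diffop_eq => f; rewrite diffop_scaleE !mulopE scalerAl. Qed.

Lemma mulop_eq0 (K : fieldType) (S : comAlgType K) (r : S) : mulop r = 0 -> r = 0.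
Proof.
by move=> /(congr1 (fun u : diffop S => u 1)); rewrite !mulopE mulr1 mul0r.
Qed.

(** * Commutation relations in D(P_n) *)

Section Relations.
Variables (K : fieldType) (n : nat).
Local Notation P := {mpoly K[n]}.
Local Notation D := (diffop P).
Local Notation dpow := (dpow K).
Implicit Types (i l : 'I_n).

Lemma diffopZ (u : D) c f : u (c *: f) = c *: u f.
Proof. exact: linearZ. Qed.

Lemma diffop_eqX (u v : D) : (forall m, u 'X_[m] = v 'X_[m]) -> u = v.
Proof.
move=> uv; apply: diffop_eq => f; rewrite [f]mpolyE !linear_sum.
by apply: eq_bigr => m _; rewrite !linearZ /= uv.
Qed.

Lemma dpowX i j m : dpow i j 'X_[m] = 'C(m i, j)%:R *: 'X_[m - U_(i) *+ j].
Proof. exact: dpow_funX. Qed.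

Lemma diffop_natmulE (u : D) f a : (u *+ a) f = u f *+ a.
Proof. by elim: a => [|a IH]; rewrite ?mulr0n ?mulopE ?mul0r // !mulrS -IH. Qed.

Lemma dpow0 i : dpow i 0 = 1 :> D.
Proof.
apply: diffop_eqX => m.
by rewrite dpowX bin0 mulm0n subm0 scale1r mulopE mul1r.
Qed.

(** Both sides are the multinomial coefficient m! / (a! b! (m-a-b)!) when a + b <= m, and zero
    otherwise. *)
Lemma mul_bin_bin m a b : ('C(m, a + b) * 'C(a + b, a) = 'C(m, b) * 'C(m - b, a))%N.
Proof.
have [le_m|lt_m] := leqP (a + b) m; last first.
  rewrite bin_small // mul0n; have [le_bm|lt_mb] := leqP b m.
    by rewrite [X in (_ * X)%N]bin_small ?muln0 // ltn_subLR // addnC.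
  by rewrite bin_small.
have le_bm : (b <= m)%N := leq_trans (leq_addl a b) le_m.
have le_am : (a <= m - b)%N by rewrite leq_subRL // addnC.
have facts : (0 < a`! * b`! * (m - (a + b))`!)%N by rewrite !muln_gt0 !fact_gt0.
apply/eqP; rewrite -(eqn_pmul2r facts); apply/eqP.
have := bin_fact le_m; have := bin_fact (leq_addr b a); rewrite addKn => Eab Em.
have := bin_fact le_bm; have := bin_fact le_am; rewrite -subnDA (addnC b) => Ea Eb.
transitivity m`!; first by rewrite -Em -Eab; nia.
by rewrite -Eb -Ea; nia.
Qed.

Lemma dpow_mul i a b : dpow i a * dpow i b = dpow i (a + b) *+ 'C(a + b, a) :> D.
Proof.
apply: diffop_eqX => m; rewrite diffop_mulE diffop_natmulE !dpowX diffopZ dpowX.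
rewrite scalerA -natrM !(mnmDE, mnmBE, mulmnE, mnm1E) eqxx mul1n -scaler_nat scalerA -natrM.
rewrite [('C(a + b, a) * _)%N]mulnC mul_bin_bin; congr (_ *: 'X_[_]).
by apply/mnmP => l; rewrite !(mnmDE, mnmBE, mulmnE, mnm1E); lia.
Qed.

Lemma dpow_mulX i j : dpow i j.+1 * mulop 'X_i = mulop 'X_i * dpow i j.+1 + dpow i j :> D.
Proof.
apply: diffop_eq => f; rewrite diffop_addE !diffop_mulE !mulopE.
have := dpow_commX i j i f; rewrite /= eqxx scale1r => /eqP.
by rewrite subr_eq addrC -subr_eq opprK addrC => /eqP.
Qed.

Lemma comm_dpow_X i l j : l != i -> GRing.comm (dpow i j) (mulop 'X_l : D).
Proof.
move=> neq_li; case: j => [|j]; first by rewrite dpow0; exact/commr_sym/commr1.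
apply: diffop_eq => f; rewrite !diffop_mulE !mulopE.
have := dpow_commX i j l f; rewrite /= (negbTE neq_li) scale0r oppr0 => /eqP.
by rewrite subr_eq0 => /eqP.
Qed.

Lemma comm_dpow_dpow i l a b : l != i -> GRing.comm (dpow i a : D) (dpow l b).
Proof.
move=> neq_li; apply: diffop_eqX => m; rewrite !diffop_mulE !dpowX !diffopZ !dpowX.
rewrite !scalerA !(mnmDE, mnmBE, mulmnE, mnm1E) [i == l]eq_sym (negbTE neq_li).
rewrite !mul0n !subn0 mulrC; congr (_ *: 'X_[_]).
by apply/mnmP => k; rewrite !(mnmDE, mnmBE, mulmnE, mnm1E); lia.
Qed.

Lemma comm_mulop (r s : P) : GRing.comm (mulop r) (mulop s).
Proof. by rewrite /GRing.comm -!rmorphM mulrC. Qed.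

End Relations.

Lemma sum_partition (V : nmodType) (I : eqType) (E : seq I) (a b : I -> nat)
    (F : I -> V) m q : (forall x, x \in E -> a x < m /\ b x < q)%N ->
  \sum_(i < m) \sum_(j < q) \sum_(x <- E | (a x == i) && (b x == j)) F x = \sum_(x <- E) F x.
Proof.
move=> lt_ab; rewrite pair_big /=.
under eq_bigr => ij _ do rewrite big_mkcond.
rewrite exchange_big /=; apply: eq_big_seq => x /lt_ab[lt_a lt_b].
rewrite -big_mkcond (big_pred1 (Ordinal lt_a, Ordinal lt_b)) // => -[i j].
by rewrite [RHS]xpair_eqE -!val_eqE /= [i == _ :> nat]eq_sym [j == _ :> nat]eq_sym.
Qed.

Lemma commr_scale (K : pzRingType) (A : algType K) (c : K) (u v : A) :
  GRing.comm u v -> GRing.comm u (c *: v).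
Proof. by move=> uv; rewrite /GRing.comm -scalerAr uv scalerAl. Qed.

Lemma scale_pull (K : pzRingType) (A : algType K) (M : lmodType A)
    (c : K) (u v r s : A) (m : M) :
  (c *: (u * v * r * s)) *: m = u *: (v *: ((c *: (r * s)) *: m)).
Proof. by rewrite !scalerA -!scalerAr !mulrA. Qed.

(** * The subrings K[x_S] and a maximal free set of variables *)

Section PolynomialRing.
Variables (K : fieldType) (p n : nat).
Hypothesis pcharKp : p \in [pchar K].
Local Notation P := {mpoly K[n]}.
Local Notation D := (diffop P).
Variable M : lmodType D.

Local Notation x_ i := (mulop 'X_i : D).
Local Notation d_ i j := (dpow K i j : D).

Definition supported (S : {set 'I_n}) (r : P) :=
  forall m, m \in msupp r -> forall i, i \notin S -> m i = 0%N.

Section Supported.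
Variable S : {set 'I_n}.

Lemma supported0 : supported S 0.
Proof. by move=> m; rewrite msupp0. Qed.

Lemma supportedX (m : 'X_{1..n}) : (forall i, i \notin S -> m i = 0%N) -> supported S 'X_[m].
Proof. by move=> mS m'; rewrite msuppX inE => /eqP ->. Qed.

Lemma supportedD r s : supported S r -> supported S s -> supported S (r + s).
Proof.
by move=> Sr Ss m /msuppD_le; rewrite mem_cat => /orP[/Sr|/Ss].
Qed.

Lemma supportedZ c r : supported S r -> supported S (c *: r).
Proof. by move=> Sr m /msuppZ_le /Sr. Qed.

Lemma supportedM r s : supported S r -> supported S s -> supported S (r * s).
Proof.
move=> Sr Ss m /msuppM_le /allpairsP[[m1 m2] /= [/Sr m1S /Ss m2S ->]] i iS.
by rewrite mnmDE m1S ?m2S.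
Qed.

Lemma supported_sum (I : eqType) (E : seq I) (Q : pred I) (F : I -> P) :
  (forall x, x \in E -> Q x -> supported S (F x)) -> supported S (\sum_(x <- E | Q x) F x).
Proof.
move=> SF; rewrite big_seq_cond; apply: (big_ind (supported S)) => [|r s|x].
- exact: supported0.
- exact: supportedD.
- by case/andP; exact: SF.
Qed.

Lemma supported_const c : supported S (c *: 1).
Proof. by rewrite -mpolyX0; apply/supportedZ/supportedX => i _; rewrite mnm0E. Qed.

Lemma comm_supported i j r : supported S r -> i \notin S -> GRing.comm (d_ i j) (mulop r).
Proof.
move=> Sr iS; rewrite [r]mpolyE rmorph_sum /= big_seq; apply: commr_sum => m mr.
rewrite mulopZ; apply: commr_scale; rewrite mpolyXE_id rmorph_prod.
apply: commr_prod => l _; rewrite rmorphXn.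
have [->|/comm_dpow_X lC] := eqVneq l i; first by rewrite (Sr _ mr _ iS) expr0; exact: commr1.
exact/commrX/lC.
Qed.

End Supported.

(** Grouping the monomials by their exponent in x_i gives annihilators the form required by
    [one_variable]. *)
Lemma polynomial_in_variable (S : {set 'I_n}) i r : supported (i |: S) r ->
  exists2 g : {poly D}, g.[x_ i] = mulop r &
    forall j, exists2 s, supported S s & g`_j = mulop s.
Proof.
move=> Sr.
pose s m := r@_m *: 'X_[m - U_(i) *+ m i] : P.
exists (\sum_(m <- msupp r) mulop (s m) *: 'X^(m i)).
  rewrite horner_sum [in RHS](mpolyE r) rmorph_sum; apply: eq_bigr => m _ /=.
  rewrite hornerZ hornerXn -rmorphXn -rmorphM /s -scalerAl mpolyXn -mpolyXD submK //.
  by apply/mnm_lepP => l; rewrite mulmnE mnm1E; case: eqP => [<-|_]; rewrite ?mul1n ?mul0n.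
move=> j; exists (\sum_(m <- msupp r | j == m i) s m).
  apply: supported_sum => m mr _; apply/supportedZ/supportedX => l lS.
  rewrite mnmBE mulmnE mnm1E; have [<-|neq_il] := eqVneq i l; first by rewrite mul1n subnn.
  by rewrite mul0n subn0 (Sr m mr) // in_setU1 negb_or eq_sym neq_il.
rewrite coef_sum rmorph_sum [RHS]big_mkcond; apply: eq_bigr => m _ /=.
by rewrite coefZ coefXn; case: eqP => _; rewrite ?mulr1 ?mulr0.
Qed.

Definition free_over S (v : M) := forall r, supported S r -> mulop r *: v = 0 -> r = 0.

(** Without variables only constants remain; a nonzero one is invertible, so any nonzero x will
    do. *)
Lemma exists_free_set0 : (exists x : M, x != 0) -> exists v, free_over set0 v.
Proof.
case=> x x_neq0; exists x => r Sr rx0; apply: contraNeq x_neq0 => r_neq0.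
have r_const : r = r@_0%MM *: 1.
  apply/mpolyP => m; rewrite mcoeffZ mcoeff1; have [->|m_neq0] := eqVneq m 0%MM.
    by rewrite mulr1.
  rewrite mulr0; apply: memN_msupp_eq0; apply: contra m_neq0 => mr.
  by apply/eqP/mnmP => i; rewrite (Sr m mr) ?inE ?mnm0E.
have c_neq0 : r@_0%MM != 0.
  by apply: contraNneq r_neq0 => c0; rewrite r_const c0 scale0r.
have := congr1 (fun y => mulop ((r@_0%MM)^-1 *: 1) *: y) rx0.
rewrite /= scaler0 scalerA -rmorphM [in X in _ * X]r_const -scalerAl mul1r scalerA.
by rewrite mulVf // scale1r rmorph1 scale1r => ->.
Qed.

Lemma exists_maximal_free : (exists x : M, x != 0) ->
  exists S : {set 'I_n}, (exists v, free_over S v) /\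
    forall i, i \notin S -> forall m : M, exists r,
      [/\ r != 0, supported (i |: S) r & mulop r *: m = 0].
Proof.
move=> M_neq0; pose has_free S := `[< exists v, free_over S v >].
have [S /maxsetP[/asboolP freeS maxS]] := ex_maxset (P := has_free)
  (ex_intro _ set0 (asboolT (exists_free_set0 M_neq0))).
exists S; split=> // i iS m; apply: contrapT => no_r.
have : has_free (i |: S).
  apply/asboolP; exists m => r Sr rm; apply: contrapT => /eqP r_neq0.
  by apply: no_r; exists r.
by move=> /maxS/(_ (subsetUr _ _)) eqS; rewrite -eqS setU11 in iS.
Qed.

(** * Torsion over K[x_S] and induction over the variables outside S *)

Section Peeling.
Variable S : {set 'I_n}.
Hypothesis algebraic : forall i, i \notin S -> forall m : M, exists r,
  [/\ r != 0, supported (i |: S) r & mulop r *: m = 0].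

Definition torsion (m : M) := exists2 r, supported S r & r != 0 /\ mulop r *: m = 0.
Definition coefficient (u : D) := exists2 r, supported S r & u = mulop r.

Lemma subgroup_torsion : subgroup torsion.
Proof.
split.
  exists 1; last by rewrite oner_eq0 scaler0.
  by have := @supported_const S 1; rewrite scale1r.
move=> x y [r Sr [r0 rx]] [s Ss [s0 sy]]; exists (r * s); first exact: supportedM.
split; first by rewrite mulf_neq0.
rewrite scalerBr rmorphM -!scalerA sy scaler0 subr0.
by rewrite scalerA comm_mulop -scalerA rx scaler0.
Qed.

Lemma stable_torsion u : (forall r, supported S r -> GRing.comm u (mulop r)) ->
  stable u torsion.
Proof.
move=> uR m [r Sr [r0 rm]]; exists r => //; split=> //.
by rewrite scalerA -uR // -scalerA rm scaler0.
Qed.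

Lemma torsion_mulop r : stable (mulop r) torsion.
Proof. by apply: stable_torsion => s _; exact: comm_mulop. Qed.

Lemma torsion_dpow i j : i \notin S -> stable (d_ i j) torsion.
Proof. by move=> iS; apply: stable_torsion => s Ss; exact: comm_supported iS. Qed.

Lemma torsion_saturated r m : supported S r -> r != 0 ->
  torsion (mulop r *: m) -> torsion m.
Proof.
move=> Sr r0 [s Ss [s0 srm]]; exists (s * r); first exact: supportedM.
by rewrite mulf_neq0 //; split=> //; rewrite rmorphM -scalerA.
Qed.

Definition monomial_S (e : 'I_n -> nat) : 'X_{1..n} :=
  [multinom (if i \in S then e i else 0%N) | i < n].

Lemma supported_monomial_S e : supported S 'X_[monomial_S e].
Proof. by apply: supportedX => i iS; rewrite mnmE (negbTE iS). Qed.

(** The combination is r v with r in K[x_S]; as v is not torsion, r = 0, and its monomials are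
    pairwise distinct. *)
Lemma monomial_independent (I : eqType) (E : seq I) (c : I -> K) (e : I -> 'I_n -> nat) v :
  ~ torsion v -> uniq E ->
  (forall x y, x \in E -> y \in E -> (forall i, i \in S -> e x i = e y i) -> x = y) ->
  torsion (\sum_(x <- E) (c x *: mulop 'X_[monomial_S (e x)]) *: v) ->
  forall x, x \in E -> c x = 0.
Proof.
move=> Tv uE inj_e Tsum x xE.
pose r : P := \sum_(x <- E) c x *: 'X_[monomial_S (e x)].
have Sr : supported S r.
  by apply: supported_sum => y _ _; apply/supportedZ/supported_monomial_S.
have r0 : r = 0.
  apply: contrapT => /eqP r_neq0; apply: Tv; apply: (torsion_saturated Sr r_neq0).
  rewrite rmorph_sum scaler_suml; move: Tsum; congr torsion.
  by apply: eq_bigr => y _; rewrite -mulopZ.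
have := congr1 (fun r => r@_(monomial_S (e x))) r0.
rewrite /r /= mcoeff0 raddf_sum /= (bigD1_seq x) //= mcoeffZ mcoeffX eqxx mulr1.
rewrite big_seq_cond big1 ?addr0 // => y /andP[yE neq_yx].
rewrite mcoeffZ mcoeffX; case: eqP => [eq_m|_]; last by rewrite mulr0.
case/negP: neq_yx; apply/eqP/inj_e => // i iS.
by move/mnmP: eq_m => /(_ i); rewrite !mnmE iS.
Qed.

(** Induction on [ls], shrinking N at each variable. The exponents e will index a basis of Lambda
    and b the spanning vectors of V. An abstract index type lets the family be filtered by its
    exponents in one variable. *)
Lemma peel (ls : seq 'I_n) (N : M -> Prop) :
    uniq ls -> (forall i, i \in ls -> i \notin S) -> subgroup N ->
    (forall r, supported S r -> stable (mulop r) N) ->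
    (forall i, i \in ls -> stable (x_ i) N /\ forall j, stable (d_ i j) N) ->
    (exists2 m, N m & ~ torsion m) ->
  exists (k : 'I_n -> nat) (v : M), [/\ N v, ~ torsion v &
    forall (I : eqType) (E : seq I) (c : I -> K) (e b : I -> 'I_n -> nat),
      uniq E -> (forall x i, x \in E -> i \in ls -> b x i < p ^ k i)%N ->
      (forall x y, x \in E -> y \in E -> (forall i, i \in S -> e x i = e y i) ->
        (forall i, i \in ls -> e x i = e y i /\ b x i = b y i) -> x = y) ->
      torsion (\sum_(x <- E)
        (c x *: (\prod_(i <- ls) (d_ i (e x i * p ^ k i) * x_ i ^+ b x i) *
                 mulop 'X_[monomial_S (e x)])) *: v) ->
      forall x, x \in E -> c x = 0].
Proof.
elim: ls N => [|i ls IH] N.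
  move=> _ _ sN _ _ [v Nv Tv]; exists (fun=> 0%N), v; split=> // I E c e b uE _ inj_e.
  under eq_bigr do rewrite big_nil mul1r.
  by apply: monomial_independent => // x y xE yE eq_e; exact: inj_e.
case/andP=> i_ls u_ls lsS sN NR Nls N_T.
have iS : i \notin S by apply: lsS; exact: mem_head.
have [Ni Ndi] := Nls i (mem_head _ _).
have in_ls l : l \in ls -> l \in i :: ls by rewrite inE orbC => ->.
have neq_i l : l \in ls -> l != i by move=> l_ls; apply: contraNneq i_ls => <-.
have [k1 [N1 [sN1 N1_T N1_stable N1_sub N1_free]]] :
    exists (k : nat) (N' : M -> Prop), [/\ subgroup N', exists2 m, N' m & ~ torsion m,
      forall u, GRing.comm u (x_ i) -> (forall j, GRing.comm u (d_ i j)) ->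
        (forall r, coefficient r -> GRing.comm u r) -> stable u torsion -> stable u N ->
        stable u N',
      forall x, N' x -> N x
    & forall J (w : nat -> nat -> M), (forall j i, N' (w j i)) ->
        torsion (\sum_(j < J) \sum_(b < p ^ k) d_ i (j * p ^ k) *: (x_ i ^+ b *: w j b)) ->
        forall j b, (j < J)%N -> (b < p ^ k)%N -> torsion (w j b)].
  apply: (@one_variable K p D (x_ i) (dpow K i) pcharKp) => //.
  - exact: dpow0.
  - by move=> a b; exact: dpow_mul.
  - by move=> j; exact: dpow_mulX.
  - move=> a _ [r Sr ->]; exists (a%:R *: r); first exact: supportedZ.
    by rewrite mulopZ scaler_nat.
  - by exists 0; [exact: supported0|rewrite rmorph0].
  - by move=> _ _ [r _ ->] [s _ ->]; exact: comm_mulop.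
  - by move=> _ [r _ ->]; exact: comm_mulop.
  - by move=> _ j [r Sr ->]; apply: commr_sym; exact: comm_supported iS.
  - exact: subgroup_torsion.
  - by move=> _ [r Sr ->]; exact: torsion_mulop.
  - by move=> _ [r Sr ->]; exact: NR.
  - exact: torsion_mulop.
  - by move=> j; exact: torsion_dpow.
  - move=> _ m [r Sr ->] r0; apply: torsion_saturated => //.
    by apply: contraNneq r0 => ->; rewrite rmorph0.
  - move=> m _; have [r [r0 Sr rm]] := algebraic iS m.
    have [g g_r Rg] := polynomial_in_variable Sr.
    exists g; split=> //; last by rewrite g_r rm; exact: subgroup_torsion.1.
    by apply: contraNneq r0 => g0; apply/eqP/mulop_eq0; rewrite -g_r g0 horner0.
have N1R r : supported S r -> stable (mulop r) N1.
  move=> Sr; apply: N1_stable; [exact: comm_mulop| | |exact: torsion_mulop|exact: NR].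
    by move=> j; apply: commr_sym; exact: comm_supported iS.
  by move=> _ [s _ ->]; exact: comm_mulop.
have N1ls l : l \in ls -> stable (x_ l) N1 /\ forall j, stable (d_ l j) N1.
  move=> l_ls; have neq_li := neq_i l l_ls; have [Nl Ndl] := Nls l (in_ls l l_ls).
  split=> [|j]; apply: N1_stable => //.
  - exact: comm_mulop.
  - by move=> j; apply/commr_sym/comm_dpow_X.
  - by move=> _ [r _ ->]; exact: comm_mulop.
  - exact: torsion_mulop.
  - by apply: comm_dpow_X; rewrite eq_sym.
  - by move=> a; apply: comm_dpow_dpow; rewrite eq_sym.
  - by move=> _ [r Sr ->]; apply: (@comm_supported S) => //; exact/lsS/in_ls.
  - by apply: torsion_dpow; exact/lsS/in_ls.
have lsS' l : l \in ls -> l \notin S by move/in_ls; exact: lsS.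
have [k [v [N1v Tv free_v]]] := IH N1 u_ls lsS' sN1 N1R N1ls N1_T.
exists (fun l => if l == i then k1 else k l), v; split=> //; first exact: N1_sub.
move=> I E c e b uE lt_b inj_e.
pose F x := (c x *: (\prod_(l <- ls) (d_ l (e x l * p ^ k l) * x_ l ^+ b x l) *
                     mulop 'X_[monomial_S (e x)])) *: v.
have N1F x : N1 (F x).
  rewrite /F -[_ *: (_ * _)]/(mulop (c x *: 1) * (_ * _)).
  apply: (stableM (N1R _ (@supported_const S (c x)))) => //.
  apply: stableM; last exact/N1R/supported_monomial_S.
  apply: stable_prod => l l_ls _; have [Nl Ndl] := N1ls l l_ls.
  by apply: stableM => //; exact: stableX.
pose J := (\max_(x <- E) e x i).+1.
have lt_J x : x \in E -> (e x i < J)%N.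
  by move=> xE; rewrite ltnS; apply: (@leq_bigmax_seq _ E xpredT (fun x => e x i)).
have lt_bi x : x \in E -> (b x i < p ^ k1)%N.
  by move=> xE; have := lt_b x i xE (mem_head _ _); rewrite eqxx.
(* The coefficient of d_i^[jq] x_i^a once the sum is sorted by the exponents of the variable i. *)
pose w j a := \sum_(x <- E | (e x i == j) && (b x i == a)) F x.
have N1w j a : N1 (w j a) by apply: subgroup_sum.
move=> Tsum.
have Tw : forall j a, (j < J)%N -> (a < p ^ k1)%N -> torsion (w j a).
  apply: N1_free => //; move: Tsum; congr torsion.
  under [RHS]eq_bigr => j _ do under eq_bigr => a _ do rewrite !scaler_sumr.
  pose G x := d_ i (e x i * p ^ k1) *: (x_ i ^+ b x i *: F x).
  transitivity (\sum_(x <- E) G x).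
    apply: eq_bigr => x _; rewrite /G /F big_cons eqxx -scale_pull.
    congr ((_ *: (_ * _ * _ * _)) *: _).
    by apply: eq_big_seq => l /neq_i/negbTE ->.
  rewrite -(@sum_partition _ _ E (e^~ i) (b^~ i) G J (p ^ k1)); last first.
    by move=> x xE; rewrite lt_J // lt_bi.
  apply: eq_bigr => j _; apply: eq_bigr => a _.
  by apply: eq_bigr => x /andP[/eqP <- /eqP <-].
(* Within one such coefficient the exponents in i are fixed, so the remaining variables still
   distinguish the indices and the induction hypothesis applies. *)
move=> x xE; have := Tw _ _ (lt_J x xE) (lt_bi x xE); rewrite /w -big_filter => TwE.
apply: (free_v I _ c e b _ _ _ TwE); rewrite ?mem_filter ?eqxx ?filter_uniq //.
  move=> y l; rewrite mem_filter => /andP[_ yE] l_ls.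
  by have := lt_b y l yE (in_ls l l_ls); rewrite (negbTE (neq_i l l_ls)).
move=> y z; rewrite !mem_filter => /andP[/andP[/eqP ey /eqP by_] yE].
move=> /andP[/andP[/eqP ez /eqP bz] zE] eS eis; apply: inj_e => // l.
by rewrite inE => /orP[/eqP -> | /eis //]; rewrite ey by_ ez bz.
Qed.

End Peeling.

End PolynomialRing.

(** * From an independent family b_i v_k to the isomorphism from the tensor product *)

Lemma sum_superset (V : nmodType) (I : eqType) (E E' : seq I) (F : I -> V) :
    uniq E -> uniq E' -> {subset E <= E'} -> (forall i, i \notin E -> F i = 0) ->
  \sum_(i <- E') F i = \sum_(i <- E) F i.
Proof.
move=> uE uE' sEE' F0; rewrite (bigID (fun i => i \in E)) /= [X in _ + X]big1 // addr0.
rewrite -big_filter; apply: perm_big; apply: uniq_perm; rewrite ?filter_uniq //.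
by move=> i; rewrite mem_filter; case: (boolP (i \in E)) => // /sEE' ->.
Qed.

Section FreeFamily.
Variables (K : fieldType) (A : algType K) (M : lmodType A) (L : subalgClosed A).
Variables (I : choiceType) (d : nat) (b : I -> A) (v : 'I_d -> M).
Hypothesis spanL : forall u, u \in L <-> lin_span (fun w => exists i, w = b i) u.
Hypothesis independent : forall (E : seq (I * 'I_d)) (c : I * 'I_d -> K), uniq E ->
  \sum_(x <- E) (c x *: b x.1) *: v x.2 = 0 -> forall x, x \in E -> c x = 0.

(** Repeated generators are merged. Coordinates vanishing off E allow several elements to be written
    over one common support. *)
Lemma L_coordinates u : u \in L -> exists E : seq I, exists2 c : I -> K,
  uniq E /\ (forall i, i \notin E -> c i = 0) & u = \sum_(i <- E) c i *: b i.
Proof.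
move=> /spanL[s sb ->]; elim: s sb => [|y s IH] sb.
  by exists [::], (fun=> 0) => //; rewrite !big_nil.
have [|E [c [uE c0] sumE]] := IH; first by move=> z zs; apply: sb; rewrite inE zs orbT.
have [i yi] := sb y (mem_head _ _).
pose E' := undup (i :: E); pose c' j := c j + y.1 *+ (j == i).
have uE' : uniq E' := undup_uniq _.
have iE' : i \in E' by rewrite mem_undup mem_head.
exists E', c'.
  split=> // j; rewrite mem_undup inE negb_or => /andP[/negbTE neq_ji jE].
  by rewrite /c' neq_ji c0 ?addr0.
have sEE' : {subset E <= E'} by move=> j jE; rewrite mem_undup inE jE orbT.
rewrite big_cons sumE; under [RHS]eq_bigr do rewrite scalerDl.
rewrite big_split /= (sum_superset uE uE' sEE') => [|j /c0 ->]; last by rewrite scale0r.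
rewrite addrC; congr (_ + _); rewrite (bigD1_seq i) //= eqxx big1 ?addr0 ?yi // => j.
by move=> /negbTE ->; rewrite scale0r.
Qed.

Lemma free_over_L (l : 'I_d -> A) : (forall k, l k \in L) ->
  \sum_k l k *: v k = 0 -> forall k, l k = 0.
Proof.
move=> lL sum0.
have /choice[E /choice[c Ec]] : forall k, exists E : seq I, exists c : I -> K,
    [/\ uniq E, forall i, i \notin E -> c i = 0 & l k = \sum_(i <- E) c i *: b i].
  by move=> k; have [E [c []]] := L_coordinates (lL k); exists E, c.
pose E' := undup (flatten [seq E k | k <- enum 'I_d]).
have uE' : uniq E' := undup_uniq _.
have lE' k : l k = \sum_(i <- E') c k i *: b i.
  have [uE c0 ->] := Ec k; apply/esym/sum_superset => // [i iE|i /c0 ->].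
    rewrite mem_undup; apply/flattenP; exists (E k) => //.
    by apply/map_f; rewrite mem_enum.
  by rewrite scale0r.
pose E2 := [seq (i, k) | i <- E', k <- enum 'I_d].
have uE2 : uniq E2.
  by apply: allpairs_uniq; rewrite ?enum_uniq // => -[i k] [j m] _ _ [-> ->].
have c0 : forall x, x \in E2 -> c x.2 x.1 = 0.
  apply: independent => //; rewrite big_allpairs exchange_big /= big_enum -[RHS]sum0.
  by apply: eq_bigr => k _; rewrite lE' scaler_suml.
move=> k; rewrite lE' big1_seq // => i /andP[_ iE'].
by rewrite (c0 (i, k)) ?scale0r //; apply: allpairs_f; rewrite ?mem_enum.
Qed.

Local Notation MK := (restr (GRing.in_alg A) M).

Definition span_v : {pred MK} :=
  fun x => `[< exists c : 'I_d -> K, x = \sum_k c k *: (v k : MK) >].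

Fact span_v_closed : submod_closed span_v.
Proof.
split; first by apply/asboolP; exists (fun=> 0); rewrite big1 // => k _; rewrite scale0r.
move=> a x y /asboolP[c ->] /asboolP[c' ->]; apply/asboolP.
exists (fun k => a * c k + c' k); rewrite scaler_sumr -big_split /=.
by apply: eq_bigr => k _; rewrite scalerDl scalerA.
Qed.

HB.instance Definition _ := GRing.isSubmodClosed.Build K MK span_v span_v_closed.

Definition V : submodClosed MK := span_v.

Fact span_v_mem k : (v k : MK) \in V.
Proof.
apply/asboolP; exists (fun j => (j == k)%:R); rewrite (bigD1 k) //= eqxx scale1r.
by rewrite big1 ?addr0 // => j /negbTE ->; rewrite scale0r.
Qed.

Definition basis_v k : submod V := Submod (span_v_mem k).

Lemma span_vP (x : submod V) : exists c : 'I_d -> K, x = \sum_k c k *: basis_v k.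
Proof.
have /asboolP[c xc] := valP x; exists c; apply: val_inj; rewrite xc raddf_sum /=.
by apply: eq_bigr => k _.
Qed.

Lemma basis_v_free (c : 'I_d -> K) : \sum_k c k *: basis_v k = 0 -> forall k, c k = 0.
Proof.
move=> /(congr1 val); rewrite raddf_sum /= => sum0 k.
(* Independence over K is the case of scalar coefficients in L. *)
have := @free_over_L (fun k => c k *: 1) (fun k => rpredZ _ (rpred1 L)).
by move=> /(_ sum0 k) /eqP; rewrite scaler_eq0 oner_eq0 orbF => /eqP.
Qed.

Lemma span_v_vector : inhabited (Vector.axiom d (submod V)).
Proof.
have [c xc] := choice span_vP.
have c_uniq x c' : x = \sum_k c' k *: basis_v k -> c x =1 c'.
  move=> xc' k; apply/eqP; rewrite -subr_eq0; apply/eqP.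
  apply: (basis_v_free (c := fun k => c x k - c' k)).
  by under eq_bigr do rewrite scalerBl; rewrite sumrB -xc -xc' subrr.
constructor; exists (fun x => \row_k c x k).
  move=> a x y; apply/rowP => k; rewrite !mxE; apply: (c_uniq _ (fun k => a * c x k + c y k)).
  rewrite {1}(xc x) {1}(xc y) scaler_sumr -big_split /=.
  by apply: eq_bigr => j _; rewrite scalerDl scalerA.
exists (fun r : 'rV_d => \sum_k r 0 k *: basis_v k) => [x|r].
  by under eq_bigr do rewrite mxE; rewrite -xc.
by apply/rowP => k; rewrite mxE; exact: (c_uniq _ (fun k => r 0 k)).
Qed.

Local Notation tensorLV := (tensor (subalg L) (submod V)).

Lemma pureDl (a a' : subalg L) (w : submod V) : pure (a + a') w = pure a w + pure a' w.
Proof. by rewrite /pure [RHS]tensor_add_pi; apply/tensor_eqP; exact: TensorDl. Qed.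

Lemma pureDr (a : subalg L) (w w' : submod V) : pure a (w + w') = pure a w + pure a w'.
Proof. by rewrite /pure [RHS]tensor_add_pi; apply/tensor_eqP; exact: TensorDr. Qed.

Lemma pureZ c (a : subalg L) (w : submod V) : pure a (c *: w) = pure (c *: a) w.
Proof. by apply/esym/tensor_eqP; exact: TensorZ. Qed.

Lemma pure0l (w : submod V) : pure (0 : subalg L) w = 0.
Proof. by apply/tensor_eqP; exact: Tensor0. Qed.

Lemma pure0r (a : subalg L) : pure a (0 : submod V) = 0.
Proof. by rewrite -(scale0r 0) pureZ scale0r pure0l. Qed.

(** Bilinearity moves scalars to the left factor; injectivity of the natural map then reduces to
    [free_over_L]. *)
Lemma tensor_normal_form (t : tensorLV) :
  exists l : 'I_d -> subalg L, t = \sum_k pure (l k) (basis_v k).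
Proof.
elim/quotW: t; elim=> [|[a w] s [l sl]].
  by exists (fun=> 0); rewrite big1 // => k _; exact: pure0l.
have [c wc] := span_vP w.
exists (fun k => c k *: a + l k); under eq_bigr do rewrite pureDl -pureZ.
rewrite big_split /= -sl -(big_morph (pure a) (pureDr a) (pure0r a)) -wc.
exact/esym/tensor_add_pi.
Qed.

Lemma natural_map_iso : lmod_iso (natural_map L V).
Proof.
have inj_nat : injective (natural_map L V).
  apply: raddf_inj => t; have [l ->] := tensor_normal_form t.
  rewrite raddf_sum => /(congr1 val) nat0.
  have /(free_over_L (fun k => valP (l k))) l0 : \sum_k val (l k) *: v k = 0.
    rewrite -[RHS]nat0 raddf_sum; apply: eq_bigr => k _.
    exact/esym/natural_map_pure.
  by rewrite big1 // => k _; rewrite (_ : l k = 0) ?pure0l //; apply: val_inj; exact: l0.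
have surj_nat y : exists t, natural_map L V t = y.
  have /mulspanP[s ys] := valP y; exists (\pi_(tensorLV) s)%qT.
  by apply: val_inj; rewrite ys; exact: val_natural_fun_pi.
have [g gK] := choice surj_nat.
by exists g => // t; apply: inj_nat; rewrite gK.
Qed.

End FreeFamily.

(** * Rearranging ordered products with partly commuting factors *)

Section NoncommutativeProducts.
Variables (A : pzRingType) (I : eqType).

Lemma prodM_commute (r : seq I) (F G : I -> A) : uniq r ->
    (forall i j, i != j -> GRing.comm (F i) (G j)) ->
  \prod_(i <- r) F i * \prod_(i <- r) G i = \prod_(i <- r) (F i * G i).
Proof.
move=> + FG; elim: r => [|i r IH] /=; first by rewrite !big_nil mulr1.
case/andP=> i_r /IH IHr; rewrite !big_cons -IHr -!mulrA; congr (_ * _).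
rewrite !mulrA; congr (_ * _); rewrite big_seq; apply/commr_sym/commr_prod => j j_r.
by apply/commr_sym/FG; apply: contraNneq i_r => <-.
Qed.

Lemma prod_commuteID (r : seq I) (Q : pred I) (F : I -> A) :
    (forall i j, Q i -> ~~ Q j -> GRing.comm (F i) (F j)) ->
  \prod_(i <- r) F i = \prod_(i <- r | ~~ Q i) F i * \prod_(i <- r | Q i) F i.
Proof.
move=> FC; elim: r => [|i r IH]; first by rewrite !big_nil mulr1.
rewrite !big_cons IH; case: (boolP (Q i)) => Qi /=; last by rewrite mulrA.
rewrite !mulrA; congr (_ * _); apply: commr_prod => j; exact: FC.
Qed.

End NoncommutativeProducts.

(** * The algebra Lambda and its monomial spanning family *)

Section MixedMonomials.
Variables (K : fieldType) (n : nat) (q : 'I_n -> nat) (S : {set 'I_n}).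
Local Notation D := (diffop {mpoly K[n]}).

(** One exponent a indexes the basis of either kind of tensor factor, so monomials of Lambda are
    indexed by ordinary multi-exponents. *)
Definition mixed_factor (i : 'I_n) (a : nat) : D :=
  if i \in S then mulop ('X_i ^+ a) else dpow K i (a * q i).

Definition mixed_monomial (m : 'X_{1..n}) : D := \prod_(i < n) mixed_factor i (m i).

Definition mixed_span : {pred D} :=
  fun u => `[< lin_span (fun w => exists m, w = mixed_monomial m) u >].

Lemma mixed_spanP u :
  reflect (lin_span (fun w => exists m, w = mixed_monomial m) u) (u \in mixed_span).
Proof. exact: asboolP. Qed.

Lemma comm_mixed_factor i j a b : i != j ->
  GRing.comm (mixed_factor i a) (mixed_factor j b).
Proof.
move=> neq_ij; rewrite /mixed_factor; case: ifP => _; case: ifP => _.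
- exact: comm_mulop.
- by rewrite rmorphXn; apply/commr_sym/commrX/comm_dpow_X.
- by rewrite rmorphXn; apply/commrX/comm_dpow_X; rewrite eq_sym.
- by apply: comm_dpow_dpow; rewrite eq_sym.
Qed.

(** The scalar is 1 or a binomial coefficient, possibly zero in K; closure of the span under
    products needs no more. *)
Lemma mixed_factorM i a b : exists c : K,
  mixed_factor i a * mixed_factor i b = c *: mixed_factor i (a + b).
Proof.
rewrite /mixed_factor; case: ifP => _.
  by exists 1; rewrite scale1r -rmorphM -exprD.
by rewrite dpow_mul -mulnDl -scaler_nat; eexists.
Qed.

Lemma mixed_factor0 i : mixed_factor i 0 = 1.
Proof. by rewrite /mixed_factor expr0 rmorph1 mul0n dpow0 if_same. Qed.

Lemma mixed_monomial_mnm1 i a : mixed_monomial (U_(i) *+ a) = mixed_factor i a.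
Proof.
rewrite /mixed_monomial (@prod_commuteID _ _ _ (pred1 i)); last first.
  by move=> j l /= /eqP -> neq_li; apply: comm_mixed_factor; rewrite eq_sym.
rewrite big1 ?mul1r => [|j /= neq_ji].
  by rewrite big_pred1_eq mulmnE mnm1E eqxx mul1n.
by rewrite mulmnE mnm1E eq_sym (negbTE neq_ji) mul0n mixed_factor0.
Qed.

Lemma mixed_monomialM m m' : exists c : K,
  mixed_monomial m * mixed_monomial m' = c *: mixed_monomial (m + m').
Proof.
rewrite /mixed_monomial prodM_commute ?index_enum_uniq //; last first.
  by move=> i j; exact: comm_mixed_factor.
have /choice[c cE] : forall i, exists c : K, mixed_factor i (m i) * mixed_factor i (m' i) =
    c *: mixed_factor i ((m + m')%MM i).
  by move=> i; rewrite mnmDE; exact: mixed_factorM.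
by exists (\prod_i c i); under eq_bigr do rewrite cE; rewrite scaler_prod.
Qed.

Lemma mixed_span_monomial m : mixed_monomial m \in mixed_span.
Proof.
apply/mixed_spanP; exists [:: (1, mixed_monomial m)]; last by rewrite big_seq1 scale1r.
by move=> y; rewrite inE => /eqP ->; exists m.
Qed.

Lemma mixed_span_linear (c : K) u w : u \in mixed_span -> w \in mixed_span ->
  c *: u + w \in mixed_span.
Proof.
move=> /mixed_spanP[s sm ->] /mixed_spanP[t tm ->]; apply/mixed_spanP.
exists ([seq (c * y.1, y.2) | y <- s] ++ t).
  by move=> y; rewrite mem_cat => /orP[/mapP[z /sm zm ->] //|/tm].
rewrite big_cat big_map scaler_sumr /=; congr (_ + _).
by apply: eq_bigr => y _; rewrite scalerA.
Qed.

Lemma mixed_span0 : 0 \in mixed_span.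
Proof. by apply/mixed_spanP; exists [::]; rewrite ?big_nil. Qed.

Lemma mixed_span_sum (I : eqType) (r : seq I) (F : I -> D) :
  (forall i, i \in r -> F i \in mixed_span) -> \sum_(i <- r) F i \in mixed_span.
Proof.
move=> rF; rewrite big_seq; apply: (big_ind (fun u => u \in mixed_span)) => //.
  exact: mixed_span0.
by move=> u w su sw; rewrite -(scale1r u); exact: mixed_span_linear.
Qed.

Lemma mixed_spanZ (c : K) u : u \in mixed_span -> c *: u \in mixed_span.
Proof. by move=> su; rewrite -[_ *: _]addr0 mixed_span_linear ?mixed_span0. Qed.

Fact mixed_span_closed : subalg_closed mixed_span.
Proof.
split; [|exact: mixed_span_linear|].
  have -> : 1 = mixed_monomial 0; last exact: mixed_span_monomial.
  by rewrite /mixed_monomial big1 // => i _; rewrite mnm0E mixed_factor0.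
move=> _ _ /mixed_spanP[s sm ->] /mixed_spanP[t tm ->].
rewrite mulr_suml; apply: mixed_span_sum => y /sm[m ->].
rewrite mulr_sumr; apply: mixed_span_sum => z /tm[m' ->].
rewrite -scalerAl -scalerAr; have [c ->] := mixed_monomialM m m'.
by do 3!apply: mixed_spanZ; exact: mixed_span_monomial.
Qed.

HB.instance Definition _ := GRing.isSubalgClosed.Build K D mixed_span mixed_span_closed.

Definition mixed_algebra : subalgClosed D := mixed_span.

Lemma mem_mixed_algebra u :
  u \in mixed_algebra <-> lin_span (fun w => exists m, w = mixed_monomial m) u.
Proof. exact: (iff_sym (rwP (mixed_spanP u))). Qed.

(** Mixed monomials are products of spanning elements of the factors. Conversely each factor lies in
    the mixed span, which is a subalgebra and so contains all products. *)
Lemma mixed_algebra_tensor (C : 'I_n -> D -> Prop) :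
    (forall i, C i = lin_span (fun w => exists a, w = mixed_factor i a)) ->
  forall u, u \in mixed_algebra <-> tensor_subalg C u.
Proof.
move=> CE u; split=> [/mixed_spanP[s sm ->]|[s sC ->]].
  exists s => // y /sm[m ->]; exists (fun i => mixed_factor i (m i)) => // i.
  rewrite CE; exists [:: (1, mixed_factor i (m i))]; last by rewrite big_seq1 scale1r.
  by move=> z; rewrite inE => /eqP ->; exists (m i).
rewrite big_seq; apply: rpred_sum => y /sC[a Ca ->]; apply/rpredZ/rpred_prod => i _.
have := Ca i; rewrite CE => -[t tf ->]; rewrite big_seq; apply: rpred_sum => z /tf[j ->].
by apply: rpredZ; rewrite -mixed_monomial_mnm1; exact: mixed_span_monomial.
Qed.

(* On monomials of degree zero in the variables of S, the X_i^(m' i) slip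
   between the factors of the mixed monomial. *)
Lemma mixed_monomial_mulX m (m' : 'X_{1..n}) : (forall i, i \in S -> m' i = 0%N) ->
  mixed_monomial m * mulop 'X_[m'] =
  \prod_(i <- [seq i <- index_enum 'I_n | i \notin S])
     (dpow K i (m i * q i) * mulop 'X_i ^+ m' i) * mulop 'X_[monomial_S S m].
Proof.
move=> m'S; rewrite mpolyXE_id rmorph_prod prodM_commute ?index_enum_uniq //; last first.
  move=> i j neq_ij; rewrite rmorphXn; apply: commrX; rewrite /mixed_factor.
  by case: ifP => _; [exact: comm_mulop|apply: comm_dpow_X; rewrite eq_sym].
rewrite (@prod_commuteID _ _ _ (fun i => i \in S)) => [|i j iS jS]; last first.
  have neq_ij : i != j by apply: contraNneq jS => <-.
  rewrite m'S // expr0 rmorph1 mulr1; apply: commrM; first exact: comm_mixed_factor.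
  by rewrite /mixed_factor iS; exact: comm_mulop.
rewrite big_filter; congr (_ * _).
  by apply: eq_bigr => i iS; rewrite /mixed_factor (negbTE iS) rmorphXn.
rewrite mpolyXE_id rmorph_prod [RHS](@prod_commuteID _ _ _ (fun i => i \in S)); last first.
  by move=> i j _ _; exact: comm_mulop.
rewrite [X in _ = X * _]big1 ?mul1r => [|i iS]; last first.
  by rewrite mnmE (negbTE iS) expr0 rmorph1.
by apply: eq_bigr => i iS; rewrite m'S // expr0 rmorph1 mulr1 /mixed_factor mnmE iS.
Qed.

End MixedMonomials.

(** * A permutation placing the variables of S first *)

Section Enumeration.
Variables (n : nat) (n_gt0 : (0 < n)%N) (S : {set 'I_n}).
Let i0 : 'I_n := Ordinal n_gt0.

Lemma card_setC_ord : #|~: S| = (n - #|S|)%N.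
Proof. by rewrite [LHS]cardsCs setCK card_ord. Qed.

Definition sorted_by_mem : seq 'I_n := enum S ++ enum (~: S).

Lemma size_sorted_by_mem : size sorted_by_mem = n.
Proof. by rewrite size_cat -!cardE cardsC card_ord. Qed.

Lemma sorted_by_mem_inj : injective (fun j : 'I_n => nth i0 sorted_by_mem j).
Proof.
move=> i j /eqP; rewrite nth_uniq ?size_sorted_by_mem // => [/eqP/val_inj //|].
rewrite cat_uniq !enum_uniq andbT /=; apply/hasPn => k.
by rewrite /= !mem_enum inE.
Qed.

Definition sorting_perm : 'S_n := perm sorted_by_mem_inj.

Lemma sorting_permV_lt i : ((sorting_perm^-1)%g i < #|S|)%N = (i \in S).
Proof.
have := permKV sorting_perm i; move: ((sorting_perm^-1)%g i) => j; rewrite permE => <-.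
rewrite nth_cat -cardE; have lt_jn := ltn_ord j.
case: ltnP => le_Sj; first by rewrite -mem_enum mem_nth // -cardE.
apply/esym/negbTE; have : nth i0 (enum (~: S)) (j - #|S|) \in enum (~: S).
  by apply: mem_nth; rewrite -cardE card_setC_ord ltn_sub2r // (leq_ltn_trans le_Sj).
by rewrite mem_enum inE.
Qed.

Lemma nth_sorting_permV (k : 'I_n -> nat) i : i \notin S ->
  nth 0%N (map k (enum (~: S))) ((sorting_perm^-1)%g i - #|S|) = k i.
Proof.
rewrite -sorting_permV_lt -leqNgt.
have := permKV sorting_perm i; move: ((sorting_perm^-1)%g i) => j; rewrite permE => <- le_Sj.
rewrite nth_cat -cardE ltnNge le_Sj /= (nth_map i0) //.
by rewrite -cardE card_setC_ord ltn_sub2r // (leq_ltn_trans le_Sj).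
Qed.

End Enumeration.

(** * Construction of Lambda and V from a maximal free set *)

Theorem theorem9p3 (K : fieldType) (p : nat) (pcharKp : p \in [pchar K])
    (n : nat) (n_gt0 : (0 < n)%N)
    (M : lmodType (diffop {mpoly K[n]})) (M_neq0 : exists x : M, x != 0) :
  exists (s : nat) (k : (n - s).-tuple nat)
    (L : subalgClosed (diffop {mpoly K[n]}))
    (V : submodClosed (restr (GRing.in_alg (diffop {mpoly K[n]})) M))
    (d : nat),
  [/\ (s <= n)%N,
      has_type p k L,
      inhabited (Vector.axiom d (submod V)),
      (p ^ (\sum_(i < n - s) tnth k i) <= d)%N
    & lmod_iso (natural_map L V)].
Proof.
have [S [[v0 v0_free] algebraic]] := exists_maximal_free M_neq0.
pose ls := [seq i <- index_enum 'I_n | i \notin S].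
have mem_ls i : (i \in ls) = (i \notin S) by rewrite mem_filter mem_index_enum andbT.
have u_ls : uniq ls by rewrite filter_uniq // index_enum_uniq.
have v0_torsion : ~ torsion S v0.
  by case=> r Sr [/eqP r0 rv]; apply: r0; exact: v0_free.
(* Peeling starts from N = M, where all stability conditions are trivial. *)
have [k0 [v [_ _ free_v]]] : exists (k : 'I_n -> nat) (v : M), [/\ True, ~ torsion S v & _] :=
    peel pcharKp algebraic (N := fun=> True) u_ls
      (fun i i_ls => etrans (esym (mem_ls i)) i_ls) (conj I (fun _ _ _ _ => I))
      (fun _ _ _ _ => I) (fun _ _ => conj (fun _ _ => I) (fun _ _ _ => I))
      (ex_intro2 _ _ v0 I v0_torsion).
(* With k i = 0 on S, the only exponent below p^(k i) there is 0: [expo] has degree zero in the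
   variables of S, and S adds nothing to the dimension. *)
pose k i := if i \in S then 0%N else k0 i.
pose q i := (p ^ k i)%N.
pose B := {dffun forall i : 'I_n, 'I_(q i)}.
pose expo (j : 'I_#|B|) : 'X_{1..n} := [multinom (enum_val j i : nat) | i < n].
have expoS j i : i \in S -> expo j i = 0%N.
  move=> iS; rewrite mnmE; case: (enum_val j i) => m /=.
  by rewrite /q /k iS expn0 ltnS leqn0 => /eqP.
pose w (j : 'I_#|B|) : M := mulop 'X_[expo j] *: v.
have free_w (E : seq ('X_{1..n} * 'I_#|B|)) c : uniq E ->
    \sum_(x <- E) (c x *: mixed_monomial K q S x.1) *: w x.2 = 0 ->
    forall x, x \in E -> c x = 0.
  move=> uE sum0; apply: (free_v _ E c (fun x => x.1) (fun x => expo x.2)) => //.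
  - move=> x i _; rewrite mem_ls mnmE => iS; apply: leq_trans (ltn_ord _) _.
    by rewrite /q /k (negbTE iS).
  - move=> [m j] [m' j'] _ _ /= eqS eq_ls; congr (_, _).
      apply/mnmP => i; have [iS|iS] := boolP (i \in S); first exact: eqS.
      by have [] := eq_ls i; rewrite ?mem_ls.
    apply: enum_val_inj; apply/ffunP => i; apply: val_inj.
    have : expo j i = expo j' i; last by rewrite !mnmE.
    have [iS|iS] := boolP (i \in S); first by rewrite !expoS.
    by have [] := eq_ls i; rewrite ?mem_ls.
  (* A relation holding in M holds modulo torsion, once it is put in the order of factors used by
     the peeling. *)
  rewrite (_ : \sum_(x <- E) _ = 0); first exact: (subgroup_torsion M S).1.
  rewrite -[RHS]sum0; apply: eq_bigr => x _; rewrite /w scalerA -scalerAl.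
  rewrite mixed_monomial_mulX; last by move=> i; exact: expoS.
  congr ((_ *: (_ * _)) *: _); apply: eq_big_seq => i; rewrite mem_ls => iS.
  by rewrite /q /k (negbTE iS).
have size_k : size (map k (enum (~: S))) == (n - #|S|)%N.
  by rewrite size_map -cardE card_setC_ord.
exists #|S|, (Tuple size_k), (mixed_algebra K q S), (V w), #|B|; split.
- by rewrite -[X in (_ <= X)%N]card_ord max_card.
- exists (sorting_perm n_gt0 S); apply: mixed_algebra_tensor => i.
  rewrite /= sorting_permV_lt; case: ifPn => iS.
    by congr lin_span; apply/funext => u; rewrite /mixed_factor iS.
  rewrite nth_sorting_permV //.
  by congr lin_span; apply/funext => u; rewrite /mixed_factor (negbTE iS).
- apply: (span_v_vector (L := mixed_algebra K q S)) free_w.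
  exact: mem_mixed_algebra.
(* The dimension #|B| is the product of the p^(k i) over all i; restricting the exponent sum to the
   complement of S gives the bound. *)
- rewrite -(big_tuple _ _ _ xpredT id) big_map /=.
  rewrite card_dep_ffun foldrE big_map /=.
  under [X in (_ <= X)%N]eq_bigr do rewrite card_ord /q.
  rewrite -expn_sum leq_pexp2l ?prime_gt0 ?(pcharf_prime pcharKp) //.
  rewrite !big_enum /= [X in (_ <= X)%N](bigID (fun i => i \in S)) /= addnC.
  by rewrite (eq_bigl (fun i => i \notin S)) ?leq_addr // => i; rewrite inE.
- apply: natural_map_iso free_w; exact: mem_mixed_algebra.
Qed.
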